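(* Let $d\ge 2$ and let $A\subset\mathbb{R}^d$ be a nonempty compact set. For each $i\in\{0,\ldots,d-1\}$ one of the following is true: (a) $\mu_i(A;\cdot)\equiv 0$ (and then, by convention, $\underline{\mathfrak m}_i(A)=\overline{\mathfrak m}_i(A)=-\infty$); (b) $i\le \underline{\mathfrak m}_i(A)\le\overline{\mathfrak m}_i(A)$. It is always true that $\mu_0(A;\cdot)\not\equiv 0$. Furthermore, $$\max_{i\in\{0,\ldots,d-1\}}\overline{\mathfrak m}_i(A)=\overline{\dim}^{\mathrm{out}}_M A\qquad\text{and}\qquad \max_{i\in\{0,\ldots,d-1\}}\underline{\mathfrak m}_i(A)\le\underline{\dim}^{\mathrm{out}}_M A .$$
   Context: Notation: $V$ is Lebesgue measure on $\mathbb{R}^d$, $|\cdot|$ the Euclidean norm, $\mathbb{S}^{d-1}$ the unit sphere, $\kappa_k=\pi^{k/2}/\Gamma(k/2+1)$, $\omega_k=k\kappa_k$, $A_\varepsilon=\{x\in\mathbb{R}^d:\mathrm{dist}(x,A)\le\varepsilon\}$. For a nonempty closed set $A\subset\mathbb{R}^d$, $\mathrm{Unp}(A)$ is the set of $y\in\mathbb{R}^d\setminus A$ having a unique nearest point $\pi_A(y)$ in $A$. The generalized normal bundle is $N(A)=\{(\pi_A(y),\frac{y-\pi_A(y)}{\mathrm{dist}(y,A)}):y\in \mathrm{Unp}(A)\}$. The local reach of $A$ at $(x,u)\in N(A)$ is $\delta(A,x,u)=\sup\{t\ge 0:\pi_A(x+tu)=x\}\in(0,\infty]$. Support measures (Hug,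 Last, Weil): for every nonempty closed $A\subset\mathbb{R}^d$ there are signed measures $\mu_0(A;\cdot),\ldots,\mu_{d-1}(A;\cdot)$ concentrated on $N(A)$ (each a difference $\mu_i^+-\mu_i^-$ of mutually singular $\sigma$-finite Borel measures on $\mathbb{R}^d\times\mathbb{S}^{d-1}$ vanishing outside $N(A)$; $|\mu_i|=\mu_i^++\mu_i^-$ is the total variation measure) such that $\int_{N(A)}\mathbf 1\{x\in B\}\min\{r,\delta(A,x,u)\}^{d-i}\,|\mu_i|(A;d(x,u))<\infty$ for all compact $B\subset\mathbb{R}^d$, $r>0$, and, for every bounded measurable $f:\mathbb{R}^d\to\mathbb{R}$ with compact support, $$\int_{\mathbb{R}^d\setminus A}f(x)\,dx=\sum_{i=0}^{d-1}\omega_{d-i}\int_0^\infty\int_{N(A)}t^{d-i-1}\mathbf 1\{t<\delta(A,x,u)\}f(x+tu)\,\mu_i(A;d(x,u))\,dt.$$ These properties determine the measures; they are called the support measures of $A$. Basic exponents: for $A$ compact and $t>0$ let $\beta_i^{\mathrm{var}}(A;t)=\int_{N(A)}\mathbf 1\{t<\delta(A,x,u)\}\,|\mu_i|(A;d(x,u))$ (which is finite). For $q\in\mathbb{R}$ put $\overline{\mathcal M}_i^{\mathrm{var},q}(A)=\limsup_{t\to0^+}t^{q-i}\beta_i^{\mathrm{var}}(A;t)$ and $\underline{\mathcal M}_i^{\mathrm{var},q}(A)=\liminf_{t\to0^+}t^{q-i}\beta_i^{\mathrm{var}}(A;t)$. The upper and lower $i$-th basic scaling exponents are $\overline{\mathfrak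 m}_i(A)=\inf\{q\in\mathbb{R}:\overline{\mathcal M}_i^{\mathrm{var},q}(A)=0\}$ and $\underline{\mathfrak m}_i(A)=\inf\{q\in\mathbb{R}:\underline{\mathcal M}_i^{\mathrm{var},q}(A)=0\}$. Outer Minkowski dimension: for $q\ge0$, $\overline{\mathcal M}^{\mathrm{out},q}(A)=\limsup_{\varepsilon\to0^+}\varepsilon^{q-d}V(A_\varepsilon\setminus A)$, $\underline{\mathcal M}^{\mathrm{out},q}(A)$ is the corresponding $\liminf$; $\overline{\dim}^{\mathrm{out}}_M A=\inf\{q\ge0:\overline{\mathcal M}^{\mathrm{out},q}(A)=0\}$ and $\underline{\dim}^{\mathrm{out}}_M A=\inf\{q\ge0:\underline{\mathcal M}^{\mathrm{out},q}(A)=0\}$. *)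

(* Defs.v *)
From HB Require Import structures.
From mathcomp Require Import all_boot all_order all_algebra.
From mathcomp Require Import all_classical all_reals all_analysis.
From mathcomp Require Import measurable_realfun.

Set Implicit Arguments.
Unset Strict Implicit.
Unset Printing Implicit Defensive.

Import Order.TTheory GRing.Theory Num.Theory.
Import numFieldNormedType.Exports.

Local Open Scope classical_set_scope.
Local Open Scope ring_scope.

Definition borel_display : measure_display.
Proof. exact: default_measure_display. Qed.

(* Matrices carry the sup-norm topology, so <<s open >> is the usual Borel      *)
(* sigma-algebra of R^n.                                                       *)
Section borel_rV.
Variables (R : realType) (n : nat).

Let borel0 : <<s (@open 'rV[R]_n) >> set0.
Proof. exact: sigma_algebra0. Qed.

Let borelC (A : set 'rV[R]_n) :
  <<s (@open 'rV[R]_n) >> A -> <<s (@open 'rV[R]_n) >> (~` A).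
Proof. by move=> sA; rewrite -setTD; exact: sigma_algebraCD. Qed.

Let borel_bigcup (F : (set 'rV[R]_n)^nat) :
  (forall i, <<s (@open 'rV[R]_n) >> (F i)) ->
  <<s (@open 'rV[R]_n) >> (\bigcup_i F i).
Proof. exact: sigma_algebra_bigcup. Qed.

HB.instance Definition _ := @isMeasurable.Build borel_display
  'rV[R]_n <<s (@open 'rV[R]_n) >> borel0 borelC borel_bigcup.

End borel_rV.

Section lebesgue.
Variable R : realType.

Lemma open_rV_measurable n (U : set 'rV[R]_n) : open U -> measurable U.
Proof. exact: sub_sigma_algebra. Qed.

Lemma ball_rV_measurable n (x : 'rV[R]_n) e : measurable (ball x e).
Proof. by apply: open_rV_measurable; apply: (@ball_open R 'rV[R]_n). Qed.

Lemma open_prod_rV_measurable n (U : set (R * 'rV[R]_n)) :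
  open U -> measurable U.
Proof.
move=> oU.
pose B (q : rat * 'rV[rat]_n * nat) : set (R * 'rV[R]_n) :=
  ball (ratr q.1.1 : R) q.2.+1%:R^-1 `*`
  ball (map_mx ratr q.1.2 : 'rV[R]_n) q.2.+1%:R^-1.
have -> : U = \bigcup_(q in [set q | B q `<=` U]) B q.
  apply/seteqP; split => [p Up|p [q qU qp]]; last exact: qU.
  have /nbhs_ballP[e /= e0 eU] : nbhs p U by exact: open_nbhs_nbhs.
  have [k ke] : exists k, 2 * k.+1%:R^-1 < e.
    exists (Num.truncn (2 / e)).
    by rewrite ltr_pdivrMr// mulrC -ltr_pdivrMr// real_truncnS_gt// num_real.
  have k0 : 0 < k.+1%:R^-1 :> R by rewrite invr_gt0.
  have {}ke : k.+1%:R^-1 + k.+1%:R^-1 <= e.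
    by move/ltW: ke; rewrite (mulr_natl _ 2) mulr2n.
  have rat_close (x : R) : exists q : rat, `|ratr q - x| < k.+1%:R^-1.
    have : x - k.+1%:R^-1 < x + k.+1%:R^-1 by rewrite ltrD2l gtrN.
    move=> /rat_in_itvoo[q]; rewrite in_itv/= => qx; exists q.
    by rewrite ltr_distl.
  have [q qp] := rat_close p.1.
  have /choice[v vp] := fun i => rat_close (p.2 ord0 i).
  exists (q, \row_i v i, k); last first.
    split; first exact: qp.
    by split => // i j; rewrite !mxE ord1; exact: vp.
  move=> y [/= y1 [_ y2]]; apply: eU; split => [|/=].
    apply: (le_ball ke).
    by apply: ball_triangle y1; exact/ball_sym.
  split => // i j; apply: (le_ball ke).
  apply: ball_triangle (y2 i j); apply/ball_sym.
  by rewrite !mxE ord1; exact: vp.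
rewrite bigcup_mkcond; apply: countable_bigcupT_measurable => // q.
case: ifPn => // _.
apply: measurableX; first exact: measurable_ball.
exact: ball_rV_measurable.
Qed.

Definition rV_cons n (p : R * 'rV[R]_n) : 'rV[R]_n.+1 := row_mx p.1%:M p.2.

Lemma rV_cons_measurable n : measurable_fun setT (@rV_cons n).
Proof.
apply: (measurability (@open 'rV[R]_n.+1)) => // _ [U oU <-]; rewrite setTI.
apply: open_prod_rV_measurable.
move: U oU; apply/continuousP => p; apply/cvgrPdist_lt => /= e e0.
have : nbhs p (ball p e) by apply/nbhs_ballP; exists e.
apply: filterS => q [qp1 [_ qp2]].
suff : ball (rV_cons p) e (rV_cons q) by rewrite mx_norm_ball.
split => // i j; rewrite !mxE.
by case: split_ordP => k _ //; rewrite !mxE !ord1.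
Qed.

Lemma rV_cons_ball n e : 0 < e ->
  @rV_cons n @^-1` ball (0 : 'rV[R]_n.+1) e =
  ball (0 : R) e `*` ball (0 : 'rV[R]_n) e.
Proof.
move=> e0; apply/seteqP; split=> [[t v]|[t v]] /=.
  move=> [_ tv]; split => /=.
    have := tv ord0 (@lshift 1 n ord0).
    by rewrite [rV_cons _ _ _]row_mxEl !mxE eqxx.
  split => // i j; have := tv i (@rshift 1 n j).
  by rewrite [rV_cons _ _ _]row_mxEr !mxE ord1.
move=> [/= et [_ ev]]; split => // i j.
rewrite !mxE; case: split_ordP => k _; first by rewrite mxE !ord1 eqxx.
by have := ev i k; rewrite mxE.
Qed.

(* Lebesgue measure on R^n.+1 = R x R^n is the product of Lebesgue measures.    *)
Fixpoint lebesgue_rV (n : nat) : set 'rV[R]_n -> \bar R :=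
  match n with
  | 0%N => \d_(0 : 'rV[R]_0)
  | m.+1 => pushforward (lebesgue_measure \x @lebesgue_rV m)%E (@rV_cons m)
  end.

Lemma sigma_finite_measure_of d (T : measurableType d) (p : set T -> \bar R) :
  p set0 = 0%E -> (forall A, 0 <= p A)%E -> semi_sigma_additive p ->
  sigma_finite setT p -> exists m : {sigma_finite_measure set T -> \bar R}, p = m.
Proof.
move=> p0 pge0 padd psf.
pose p1 := isMeasure.Build _ _ _ p p0 pge0 padd.
pose pM : {measure set T -> \bar R} := HB.pack p p1.
pose p2 := Measure_isSigmaFinite.Build _ _ _ pM psf.
pose pS : {sigma_finite_measure set T -> \bar R} := HB.pack p p1 p2.
by exists pS.
Qed.

Lemma lebesgue_rV_subproof n :
  exists m : {sigma_finite_measure set 'rV[R]_n -> \bar R},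
    @lebesgue_rV n = m /\
    forall e, 0 < e -> (m (ball (0%R : 'rV[R]_n) e) < +oo)%E.
Proof.
elim: n => [|n [m [E mfin]]] /=.
  exists (\d_(0 : 'rV[R]_0)); split => // e e0.
  by rewrite /= /dirac ltry.
rewrite E.
pose p := pushforward (lebesgue_measure \x m)%E (@rV_cons n).
have pfin e : 0 < e -> (p (ball (0%R : 'rV[R]_n.+1) e) < +oo)%E.
  move=> e0; rewrite /p /pushforward rV_cons_ball//.
  rewrite product_measure1E; last exact: ball_rV_measurable.
    2: exact: measurable_ball.
  rewrite lte_mul_pinfty//; last exact: mfin.
  have lfin : lebesgue_measure (ball (0 : R) e) \is a fin_num.
    by rewrite lebesgue_measure_ball// ltW.
  exact: lfin.
have psf : sigma_finite setT p.
  exists (fun k => ball (0 : 'rV[R]_n.+1) k.+1%:R); last first.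
    move=> k; split; first exact: ball_rV_measurable.
    exact: pfin.
  apply/esym/seteqP; split=> // x _; exists (Num.truncn `|x|) => //.
  by rewrite -ball_normE/= sub0r normrN real_truncnS_gt// num_real.
have mcons A : measurable A -> measurable (@rV_cons n @^-1` A).
  by move=> mA; rewrite -[X in measurable X]setTI; exact: rV_cons_measurable.
have p0 : p set0 = 0%E by rewrite /p /pushforward preimage_set0 measure0.
have pge0 A : (0 <= p A)%E by rewrite /p /pushforward measure_ge0.
have padd : semi_sigma_additive p.
  move=> F mF tF mUF; rewrite /p /pushforward preimage_bigcup.
  apply: measure_semi_sigma_additive => [k||].
  - exact: mcons.
  - apply/trivIsetP => /= i j _ _ ij; rewrite -preimage_setI.
    by move/trivIsetP : tF => /(_ _ _ _ _ ij) ->//; rewrite preimage_set0.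
  - by rewrite -preimage_bigcup; exact: mcons.
have [pS pE] := sigma_finite_measure_of p0 pge0 padd psf.
by exists pS; rewrite -pE.
Qed.

Let lebesgue_rV0 n : @lebesgue_rV n set0 = 0%E.
Proof. by have [m [-> _]] := lebesgue_rV_subproof n; exact: measure0. Qed.

Let lebesgue_rV_ge0 n A : (0 <= @lebesgue_rV n A)%E.
Proof. by have [m [-> _]] := lebesgue_rV_subproof n; exact: measure_ge0. Qed.

Let lebesgue_rV_semi_sigma_additive n : semi_sigma_additive (@lebesgue_rV n).
Proof.
have [m [-> _]] := lebesgue_rV_subproof n.
exact: measure_semi_sigma_additive.
Qed.

HB.instance Definition _ n := isMeasure.Build _ _ _ (@lebesgue_rV n)
  (lebesgue_rV0 n) (@lebesgue_rV_ge0 n) (@lebesgue_rV_semi_sigma_additive n).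

Let lebesgue_rV_sigma_finite n : sigma_finite setT (@lebesgue_rV n).
Proof.
have [m [-> _]] := lebesgue_rV_subproof n.
exact: sigma_finiteT.
Qed.

HB.instance Definition _ n := Measure_isSigmaFinite.Build _ _ _ (@lebesgue_rV n)
  (@lebesgue_rV_sigma_finite n).

End lebesgue.
Arguments lebesgue_rV {R n}.

Section constants.
Variable R : realType.

Definition Gamma (s : R) : R :=
  \int[lebesgue_measure]_(t in `]0, +oo[) (t `^ (s - 1) * expR (- t)).

Definition kappa (k : nat) : R := pi `^ (k%:R / 2) / Gamma (k%:R / 2 + 1).

Definition omega (k : nat) : R := k%:R * kappa k.

End constants.

(* A difference of two mutually singular sigma-finite measures. Both parts may *)
(* be infinite, so this is not a charge of the library.                       *)
Record signed_measure d (T : measurableType d) (R : realType) := SignedMeasure {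
  pos_part : {sigma_finite_measure set T -> \bar R} ;
  neg_part : {sigma_finite_measure set T -> \bar R} ;
  parts_singular : exists P : set T,
    [/\ measurable P, pos_part (~` P) = 0%E & neg_part P = 0%E] }.

Section signed_measure.
Context d (T : measurableType d) (R : realType).
Implicit Types (mu : signed_measure T R) (D : set T) (f : T -> \bar R).

Definition variation_measure mu : {measure set T -> \bar R} :=
  measure_add (pos_part mu) (neg_part mu).

Definition signed_integral mu D f : \bar R :=
  (\int[pos_part mu]_(x in D) f x - \int[neg_part mu]_(x in D) f x)%E.

(* For mutually singular parts, a zero difference forces both parts to vanish. *)
Definition signed_measure_eq0 mu : Prop :=
  forall B, measurable B -> pos_part mu B = 0%E /\ neg_part mu B = 0%E.

End signed_measure.

Section geometry.
Context (R : realType) (d : nat).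
Implicit Types (A : set 'rV[R]_d) (x y : 'rV[R]_d) (p : 'rV[R]_d * 'rV[R]_d).

(* The library norm on 'rV[R]_d is the sup norm; it only provides the topology. *)
Definition enorm x : R := Num.sqrt (\sum_(j < d) x ord0 j ^+ 2).

Definition dist A y : R := inf [set enorm (y - a) | a in A].

Definition nearest A y : set 'rV[R]_d :=
  [set x | A x /\ enorm (y - x) = dist A y].

(* The metric projection is partial, so pi_A(y) = x is stated as a relation: x *)
(* is the unique nearest point of y in A.                                     *)
Definition metric_proj A y x : Prop := nearest A y = [set x].

Definition Unp A : set 'rV[R]_d :=
  [set y | ~ A y /\ exists x, metric_proj A y x].

Definition normal_bundle A : set ('rV[R]_d * 'rV[R]_d) :=
  [set p | exists y, [/\ Unp A y, metric_proj A y p.1 &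
                          p.2 = (dist A y)^-1 *: (y - p.1)]].

Definition local_reach A p : \bar R :=
  ereal_sup [set t%:E | t in
    [set t : R | 0 <= t /\ metric_proj A (p.1 + t *: p.2) p.1]].

Definition parallel_set A (e : R) : set 'rV[R]_d := [set x | dist A x <= e].

(* The measures live on the Borel sets of R^d x R^d rather than R^d x S^(d-1): *)
(* both components of the difference vanish off the normal bundle, whose       *)
(* second components are unit vectors. Existence and uniqueness of such a      *)
(* family is the theorem of Hug, Last and Weil.                                *)
Definition support_measures A
    (mu : 'I_d -> signed_measure ('rV[R]_d * 'rV[R]_d)%type R) : Prop :=
  [/\ forall i, (variation_measure (mu i)).-negligible (~` normal_bundle A),
      forall (i : 'I_d) (B : set 'rV[R]_d) (r : R), compact B -> 0 < r ->
        (\int[variation_measure (mu i)]_(p in normal_bundle A)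
           ((\1_B p.1)%:E * mine r%:E (local_reach A p) ^+ (d - i)) < +oo)%E
    & forall f : 'rV[R]_d -> R, measurable_fun setT f ->
        (exists M : R, forall x, `|f x| <= M) ->
        compact (closure [set x | f x != 0]) ->
        (\int[lebesgue_rV]_(x in ~` A) (f x)%:E =
         \sum_(i < d) (omega R (d - i))%:E *
           \int[lebesgue_measure]_(t in `]0%R, +oo[)
             signed_integral (mu i) (normal_bundle A)
               (fun p => (t ^+ (d - i - 1) *
                          \1_[set q | (t%:E < local_reach A q)%E] p *
                          f (p.1 + t *: p.2))%:E))%E ].

Section basic_exponents.
Variables (A : set 'rV[R]_d) (i : nat).
Variable mui : signed_measure ('rV[R]_d * 'rV[R]_d)%type R.

Definition beta_var (t : R) : \bar R :=
  \int[variation_measure mui]_(p in normal_bundle A)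
    (\1_[set q | (t%:E < local_reach A q)%E] p)%:E.

Definition upper_Mvar (q : R) : \bar R :=
  limf_esup (fun t => ((t `^ (q - i%:R))%:E * beta_var t)%E) 0^'+.

Definition lower_Mvar (q : R) : \bar R :=
  limf_einf (fun t => ((t `^ (q - i%:R))%:E * beta_var t)%E) 0^'+.

Definition upper_exponent : \bar R :=
  ereal_inf [set q%:E | q in [set q | upper_Mvar q = 0%E]].

Definition lower_exponent : \bar R :=
  ereal_inf [set q%:E | q in [set q | lower_Mvar q = 0%E]].

End basic_exponents.

Section outer_Minkowski.
Variable A : set 'rV[R]_d.

Definition upper_Mout (q : R) : \bar R :=
  limf_esup (fun e =>
    ((e `^ (q - d%:R))%:E * lebesgue_rV (parallel_set A e `\` A))%E) 0^'+.

Definition lower_Mout (q : R) : \bar R :=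
  limf_einf (fun e =>
    ((e `^ (q - d%:R))%:E * lebesgue_rV (parallel_set A e `\` A))%E) 0^'+.

Definition upper_dim_out : \bar R :=
  ereal_inf [set q%:E | q in [set q | 0 <= q /\ upper_Mout q = 0%E]].

Definition lower_dim_out : \bar R :=
  ereal_inf [set q%:E | q in [set q | 0 <= q /\ lower_Mout q = 0%E]].

End outer_Minkowski.

End geometry.

(* Main.v *)
(* Let N_t be the set of (x, u) in N(A) whose local reach exceeds t; it is     *)
(* Borel, being a countable union of closed sets, and                          *)
(* beta_i^var(A; t) = |mu_i|(N_t). The Steiner formula yields two estimates.   *)
(*                                                                             *)
(* For B a Borel subset of N_t, the indicator of {x + ru | (x, u) in B,        *)
(* 0 < r <= s} turns the Steiner formula into: the volume of this set is a     *)
(* polynomial in s in ]0, t] with coefficients omega_k mu_(d-k)(B) / k. It is  *)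
(* bounded by V(A_t \ A), so inverting a Vandermonde matrix bounds the         *)
(* coefficients; applied to the two parts of a Hahn decomposition of mu_i this *)
(* gives |mu_i|(N_t) <= C t^(i-d) V(A_t \ A). Hence both basic exponents are   *)
(* at most the corresponding outer dimension.                                  *)
(*                                                                             *)
(* Conversely, V(A_T \ A_s) <= sum_i |omega_(d-i)| T^(d-i) |mu_i|(N_s) for     *)
(* s <= T. With T = 2s and a geometric summation of shells, a power bound on   *)
(* all |mu_i|(N_s) becomes a power bound on V(A_s \ A). With s = 1 and T       *)
(* large, mu_0 = 0 would give V(A_T) = O(T^(d-1)), which is absurd. Finally    *)
(* |mu_i|(N_t) increases to |mu_i|(N(A)) as t decreases to 0, so it stays      *)
(* away from 0 unless mu_i = 0; this is case (b).                              *)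

Require Import Defs.
From HB Require Import structures.
From mathcomp Require Import all_boot all_order all_algebra.
From mathcomp Require Import all_classical all_reals all_analysis.
From mathcomp Require Import measurable_realfun ring lra.

Set Implicit Arguments.
Unset Strict Implicit.
Unset Printing Implicit Defensive.

Import Order.TTheory GRing.Theory Num.Theory.
Import numFieldNormedType.Exports.

Local Open Scope classical_set_scope.
Local Open Scope ring_scope.

(** * Euclidean norm, distance and normal bundle *)

(** Write N_t for [reach_gt A t], b_i(t) for |mu_i|(N_t) and v(t) for V(A_t \ A). The bounds of the
    exponents by the outer dimensions, and the converse for the upper ones, come from two
    inequalities between these functions, both read off [steiner_set]. [variation_le_volume] says
    b_i(t) <= C_i t^(i-d) v(t) with C_i independent of t; being pointwise in t, it passes to limsup
    and liminf alike and yields [upper_exponent_le_dim] and [lower_exponent_le_dim].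

    [shell_volume_le] goes the other way, but it bounds only a shell A_T \ A_s, through the b_i at
    the inner radius. Recovering v(t) takes a sum over all radii t / 2^k ([volume_le_powR]), hence a
    power bound on the b_i at every small radius. An upper exponent supplies one; a lower exponent
    supplies one only along a sequence of radii. So [upper_dim_out_le_max] concerns the upper
    exponents alone.

    The outer dimension is an infimum over q >= 0. This constraint is harmless, since [mu0_neq0] and
    [lower_exponent_ge] make the maximum of the exponents nonnegative. *)

Section euclidean_norm.
Context (R : realType) (d : nat).
Implicit Types x y z : 'rV[R]_d.

Definition dotp x y : R := \sum_(j < d) x ord0 j * y ord0 j.

Lemma dotpC x y : dotp x y = dotp y x.
Proof. by apply: eq_bigr => j _; rewrite mulrC. Qed.

Lemma dotpDl x y z : dotp (x + y) z = dotp x z + dotp y z.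
Proof. by rewrite -big_split; apply: eq_bigr => j _; rewrite mxE mulrDl. Qed.

Lemma dotpZl c x y : dotp (c *: x) y = c * dotp x y.
Proof. by rewrite mulr_sumr; apply: eq_bigr => j _; rewrite mxE mulrA. Qed.

Lemma dotp_ge0 x : 0 <= dotp x x.
Proof. by apply: sumr_ge0 => j _; rewrite -expr2 sqr_ge0. Qed.

Lemma dotp_eq0 x : dotp x x = 0 -> x = 0.
Proof.
move/eqP; rewrite psumr_eq0; last by move=> j _; rewrite -expr2 sqr_ge0.
move=> /allP h; apply/rowP => j; rewrite mxE.
by have := h j (mem_index_enum _); rewrite /= mulf_eq0 orbb => /eqP.
Qed.

Lemma enormE x : enorm x = Num.sqrt (dotp x x).
Proof. by congr Num.sqrt; apply: eq_bigr => j _; rewrite expr2. Qed.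

Lemma enorm_ge0 x : 0 <= enorm x.
Proof. exact: sqrtr_ge0. Qed.

Lemma enorm_sqr x : enorm x ^+ 2 = dotp x x.
Proof. by rewrite enormE sqr_sqrtr// dotp_ge0. Qed.

Lemma enorm0 : enorm (0 : 'rV[R]_d) = 0.
Proof. by rewrite /enorm big1 ?sqrtr0// => j _; rewrite mxE expr0n. Qed.

Lemma enorm_eq0 x : enorm x = 0 -> x = 0.
Proof. by move=> x0; apply: dotp_eq0; rewrite -enorm_sqr x0 expr0n. Qed.

Lemma enormZ c x : enorm (c *: x) = `|c| * enorm x.
Proof.
by rewrite !enormE dotpZl dotpC dotpZl mulrA -expr2 sqrtrM ?sqr_ge0// sqrtr_sqr.
Qed.

Lemma enormN x : enorm (- x) = enorm x.
Proof. by rewrite -scaleN1r enormZ normrN1 mul1r. Qed.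

Lemma enormB x y : enorm (x - y) = enorm (y - x).
Proof. by rewrite -enormN opprB. Qed.

Lemma enorm_sqrDZ x y s :
  enorm (x + s *: y) ^+ 2 =
  enorm x ^+ 2 + 2 * s * dotp x y + s ^+ 2 * enorm y ^+ 2.
Proof.
rewrite !enorm_sqr dotpDl (dotpC x (x + _)) (dotpC (s *: y) (x + _)) !dotpDl.
by rewrite (dotpC x (s *: y)) !dotpZl (dotpC y (s *: y)) dotpZl (dotpC y x); ring.
Qed.

(** Cauchy-Schwarz: |x + s y|^2 is nonnegative at its minimiser s = - <x, y> / |y|^2. *)
Lemma dotp_le x y : dotp x y <= enorm x * enorm y.
Proof.
have [->|y0] := eqVneq y 0.
  by rewrite enorm0 mulr0 /dotp big1// => j _; rewrite mxE mulr0.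
have y_gt0 : 0 < enorm y.
  rewrite lt_neqAle enorm_ge0 andbT eq_sym.
  by apply: contra_neq y0; exact: enorm_eq0.
have := sqr_ge0 (enorm (x + (- dotp x y / enorm y ^+ 2) *: y)).
rewrite enorm_sqrDZ.
have -> : enorm x ^+ 2 + 2 * (- dotp x y / enorm y ^+ 2) * dotp x y +
    (- dotp x y / enorm y ^+ 2) ^+ 2 * enorm y ^+ 2 =
    (enorm x ^+ 2 * enorm y ^+ 2 - dotp x y ^+ 2) / enorm y ^+ 2.
  by field; rewrite gt_eqF.
rewrite pmulr_lge0 ?invr_gt0 ?exprn_gt0// subr_ge0 -exprMn => h.
apply: (le_trans (ler_norm _)); rewrite -(@ler_pXn2r _ 2)// ?nnegrE//.
  by rewrite real_normK ?num_real.
by rewrite mulr_ge0 ?enorm_ge0.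
Qed.

Lemma enormD x y : enorm (x + y) <= enorm x + enorm y.
Proof.
rewrite -(@ler_pXn2r _ 2)// ?nnegrE ?addr_ge0 ?enorm_ge0//.
have := enorm_sqrDZ x y 1; rewrite scale1r => ->.
by rewrite sqrrD; have := dotp_le x y; nra.
Qed.

Lemma enorm_dist x y : `|enorm x - enorm y| <= enorm (x - y).
Proof.
rewrite ler_norml; apply/andP; split.
  by have := enormD (y - x) x; rewrite subrK (enormB y x); lra.
by have := enormD (x - y) y; rewrite subrK; lra.
Qed.

Lemma coord_le_enorm x j : `|x ord0 j| <= enorm x.
Proof.
rewrite -sqrtr_sqr ler_wsqrtr// (bigD1 j)//= lerDl.
by apply: sumr_ge0 => k _; rewrite sqr_ge0.
Qed.

(** The sharp constant is sqrt d; the cruder d comes from d <= d^2 and is enough to compare the two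
    norms. *)
Lemma enorm_le_coord x (e : R) : 0 <= e -> (forall j, `|x ord0 j| <= e) ->
  enorm x <= d%:R * e.
Proof.
move=> e0 xe; rewrite -(@ler_pXn2r _ 2)// ?nnegrE ?mulr_ge0 ?enorm_ge0//.
rewrite enorm_sqr; apply: (@le_trans _ _ (\sum_(j < d) e ^+ 2)).
  apply: ler_sum => j _; rewrite -expr2 -[X in X <= _]real_normK ?num_real//.
  by rewrite ler_pXn2r// ?nnegrE.
rewrite sumr_const card_ord -(mulr_natl (e ^+ 2)) exprMn ler_wpM2r ?sqr_ge0//.
by rewrite -natrX ler_nat; case: (d) => // n; rewrite expnS leq_pmulr// expn_gt0.
Qed.

Lemma norm_le_enorm x : `|x| <= enorm x.
Proof.
rewrite -[`|x|]/(mx_norm x) mx_normrE; apply: bigmax_le => [|[i j] _ /=].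
  exact: enorm_ge0.
by rewrite (ord1 i) coord_le_enorm.
Qed.

Lemma enorm_le_norm x : enorm x <= d%:R * `|x|.
Proof.
apply: enorm_le_coord => // j; rewrite -[`|x|]/(mx_norm x) mx_normrE.
exact: (le_bigmax _ (fun ij => `|x ij.1 ij.2|) (ord0, j)).
Qed.

End euclidean_norm.

Lemma enorm_lipschitz_continuous (R : realType) (d : nat) (f : 'rV[R]_d -> R) :
  (forall x y, `|f x - f y| <= enorm (x - y)) -> continuous f.
Proof.
move=> f_lip x; apply/(@cvgrPdist_lt _ _ _ (nbhs x) (nbhs_filter x)) => /= e e0.
(* The summand 1 keeps the divisor positive when d = 0. *)
have d1 : 0 < d%:R + 1 :> R by rewrite ltr_wpDl.
have : nbhs x (ball x (e / (d%:R + 1))).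
  by apply: nbhsx_ballx; rewrite divr_gt0.
rewrite mx_norm_ball; apply: filterS => z xz; apply: (le_lt_trans (f_lip _ _)).
apply: (le_lt_trans (enorm_le_norm _)).
apply: (@le_lt_trans _ _ ((d%:R + 1) * `|x - z|)); first by rewrite ler_wpM2r// lerDl.
by rewrite mulrC -ltr_pdivlMr.
Qed.

Section distance.
Context (R : realType) (d : nat) (A : set 'rV[R]_d).
Context (A_neq0 : A !=set0).
Implicit Types x y a : 'rV[R]_d.

Lemma dist_le_enorm y a : A a -> dist A y <= enorm (y - a).
Proof.
move=> Aa; apply: ge_inf; last by exists a.
by exists 0 => _ [b _ <-]; exact: enorm_ge0.
Qed.

Lemma dist_ge y (c : R) :
  (forall a, A a -> c <= enorm (y - a)) -> c <= dist A y.
Proof.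
move=> h; apply: lb_le_inf => [|_ [a Aa <-]]; last exact: h.
by case: A_neq0 => a Aa; exists (enorm (y - a)), a.
Qed.

Lemma dist_ge0 y : 0 <= dist A y.
Proof. by apply: dist_ge => a _; exact: enorm_ge0. Qed.

Lemma dist_le_add x y : dist A x <= dist A y + enorm (x - y).
Proof.
rewrite -lerBlDr; apply: dist_ge => a Aa; rewrite lerBlDr addrC.
apply: (le_trans (dist_le_enorm x Aa)).
by apply: le_trans (enormD _ _); rewrite addrA subrK.
Qed.

Lemma dist_lipschitz x y : `|dist A x - dist A y| <= enorm (x - y).
Proof.
have := dist_le_add x y; have := dist_le_add y x.
by rewrite (enormB y x) ler_norml; lra.
Qed.

Lemma dist_continuous : continuous (dist A).
Proof. exact/enorm_lipschitz_continuous/dist_lipschitz. Qed.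

Lemma dist_mem y : A y -> dist A y = 0.
Proof.
move=> Ay; apply/eqP; rewrite eq_le dist_ge0 andbT.
by rewrite (le_trans (dist_le_enorm _ Ay))// subrr enorm0.
Qed.

Context (A_compact : compact A).

Lemma dist_attained y : exists2 a, A a & enorm (y - a) = dist A y.
Proof.
have fc : continuous (fun a => enorm (y - a)).
  apply: enorm_lipschitz_continuous => a b.
  by apply: (le_trans (enorm_dist _ _)); rewrite opprB addrC addrA subrK enormB.
have [a /set_mem Aa ha] := EVT_min_rV A_neq0 A_compact (continuous_subspaceT fc).
exists a => //; apply/eqP; rewrite eq_le dist_le_enorm// andbT.
by apply: dist_ge => b Ab; apply: ha; exact/mem_set.
Qed.

Lemma dist_eq0 y : dist A y = 0 -> A y.
Proof.
have [a Aa <-] := dist_attained y.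
by move/enorm_eq0/eqP; rewrite subr_eq0 => /eqP ->.
Qed.

Lemma dist_gt0 y : (0 < dist A y) <-> ~ A y.
Proof.
split=> [y0 Ay|nAy]; first by rewrite dist_mem ?ltxx in y0.
rewrite lt_neqAle dist_ge0 andbT; apply/eqP => /esym/dist_eq0; exact: nAy.
Qed.

Lemma metric_projP y x :
  A x -> (forall a, A a -> enorm (y - a) <= enorm (y - x) -> a = x) ->
  metric_proj A y x.
Proof.
move=> Ax h; have [a Aa ya] := dist_attained y.
have ax : a = x by apply: h => //; rewrite ya dist_le_enorm.
apply/seteqP; split => [b [Ab yb]|_ ->]; last by rewrite -ax.
by apply: h => //; rewrite yb dist_le_enorm.
Qed.

Lemma metric_proj_mem y x : metric_proj A y x -> A x.
Proof. by move=> h; have [] : nearest A y x by rewrite h. Qed.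

Lemma metric_proj_dist y x : metric_proj A y x -> enorm (y - x) = dist A y.
Proof. by move=> h; have [] : nearest A y x by rewrite h. Qed.

Lemma metric_proj_inj y x x' : metric_proj A y x -> metric_proj A y x' -> x = x'.
Proof. by move=> h; rewrite /metric_proj h => /seteqP[+ _] => /(_ x erefl). Qed.

End distance.

Section normal_bundle.
Context (R : realType) (d : nat) (A : set 'rV[R]_d).
Context (A_neq0 : A !=set0) (A_compact : compact A).
Implicit Types (x u : 'rV[R]_d) (p : 'rV[R]_d * 'rV[R]_d) (r s t : R).

(* Requiring the parameter to be rational turns the set into a countable union *)
(* of closed sets; it is the set where the local reach exceeds t.              *)
Definition reach_gt t : set ('rV[R]_d * 'rV[R]_d) :=
  [set p | [/\ A p.1, enorm p.2 = 1 &
    exists2 q : rat, t < ratr q & dist A (p.1 + ratr q *: p.2) = ratr q]].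

(** The open ball of radius s about x + s u misses A, and the closed ball of radius r about x + r u
    meets the bounding sphere only at x. In formulas, eliminating <x - a, u> between the two
    expanded squares leaves (s - r) |x - a|^2 <= 0. *)
Lemma metric_proj_segment x u r s : A x -> enorm u = 1 ->
  dist A (x + s *: u) = s -> 0 <= r < s -> metric_proj A (x + r *: u) x.
Proof.
move=> Ax u1 xs /andP[r0 rs]; apply: metric_projP => // a Aa.
have s0 : 0 < s by exact: le_lt_trans rs.
rewrite [x + r *: u - x]addrC addKr enormZ u1 mulr1 ger0_norm//.
have -> : x + r *: u - a = (x - a) + r *: u by rewrite addrAC.
rewrite -(@ler_pXn2r _ 2)// ?nnegrE ?enorm_ge0// enorm_sqrDZ u1 => h1.
have : s ^+ 2 <= enorm ((x - a) + s *: u) ^+ 2.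
  rewrite ler_pXn2r// ?nnegrE ?enorm_ge0 ?(ltW s0)//.
  by rewrite -[X in X <= _]xs addrAC dist_le_enorm.
rewrite enorm_sqrDZ u1 => h2.
suff /eqP : enorm (x - a) ^+ 2 = 0.
  by rewrite expf_eq0/= => /eqP/enorm_eq0/eqP; rewrite subr_eq0 => /eqP.
have h3 := sqr_ge0 (enorm (x - a)).
have h4 : r * (enorm (x - a) ^+ 2 + 2 * s * dotp (x - a) u) >= 0.
  by rewrite mulr_ge0//; lra.
have h5 : s * (enorm (x - a) ^+ 2 + 2 * r * dotp (x - a) u) <= 0.
  by rewrite mulr_ge0_le0 ?(ltW s0)//; lra.
have h6 : (s - r) * enorm (x - a) ^+ 2 <= 0 by nra.
apply/eqP; rewrite eq_le h3 andbT.
by move: h6; rewrite pmulr_rle0// subr_gt0.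
Qed.

Lemma dist_of_proj x u r : enorm u = 1 -> 0 <= r ->
  metric_proj A (x + r *: u) x -> dist A (x + r *: u) = r.
Proof.
move=> u1 r0 /metric_proj_dist <-.
by rewrite [x + r *: u - x]addrC addKr enormZ u1 mulr1 ger0_norm.
Qed.

Lemma normal_bundleP p : normal_bundle A p <->
  [/\ A p.1, enorm p.2 = 1 &
      exists2 s, 0 < s & metric_proj A (p.1 + s *: p.2) p.1].
Proof.
split=> [[y [[nAy _] yp p2]]|[Ap p1 [s s0 sp]]].
  have y0 : 0 < dist A y by apply/dist_gt0.
  split; first exact: metric_proj_mem yp.
    rewrite p2 enormZ (metric_proj_dist yp) ger0_norm ?invr_ge0 ?ltW//.
    by rewrite mulVf// gt_eqF.
  exists (dist A y) => //.
  by rewrite p2 scalerA mulfV ?gt_eqF// scale1r addrC subrK.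
have ds : dist A (p.1 + s *: p.2) = s by apply: dist_of_proj => //; exact: ltW.
exists (p.1 + s *: p.2); split => //.
  by split; [apply/dist_gt0 => //; rewrite ds|exists p.1].
by rewrite ds [_ + _ - _]addrC addKr scalerA mulVf ?gt_eqF// scale1r.
Qed.

Lemma reach_gt_sub s t : s <= t -> reach_gt t `<=` reach_gt s.
Proof.
by move=> st p [Ap p1 [q tq dq]]; split => //; exists q => //; exact: le_lt_trans tq.
Qed.

Lemma reach_gt_proj t p r : reach_gt t p -> 0 <= r <= t ->
  metric_proj A (p.1 + r *: p.2) p.1.
Proof.
move=> [Ap p1 [q tq dq]] /andP[r0 rt].
by apply: metric_proj_segment dq _ => //; rewrite r0 (le_lt_trans rt).
Qed.

Lemma reach_gt_dist t p r : reach_gt t p -> 0 <= r <= t ->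
  dist A (p.1 + r *: p.2) = r.
Proof.
move=> pt rt; have [_ p1 _] := pt; apply: dist_of_proj => //.
  by case/andP: rt.
exact: reach_gt_proj pt rt.
Qed.

(** Both directions shrink a segment by [metric_proj_segment]. From right to left a second rational
    strictly between t and q is chosen, because at parameter q itself the nearest point need not be
    unique. *)
Lemma reach_gtP t p : 0 <= t ->
  normal_bundle A p /\ (t%:E < local_reach A p)%E <-> reach_gt t p.
Proof.
move=> t0; split=> [[/normal_bundleP[Ap p1 _]]|pt].
  move=> /ereal_sup_gt[_ [s [s0 sp] <-]]; rewrite lte_fin => ts.
  have ds := dist_of_proj p1 s0 sp.
  have [q] := rat_in_itvoo ts; rewrite in_itv/= => /andP[tq qs].
  have q0 : 0 <= ratr q :> R by exact: le_trans (ltW tq).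
  split => //; exists q => //; apply: dist_of_proj => //.
  by apply: metric_proj_segment ds _ => //; rewrite q0.
have [Ap p1 [q tq dq]] := pt.
have [r] := rat_in_itvoo tq; rewrite in_itv/= => /andP[tr rq].
have r0 : 0 < ratr r :> R by exact: le_lt_trans tr.
have rp : metric_proj A (p.1 + ratr r *: p.2) p.1.
  by apply: metric_proj_segment dq _ => //; rewrite ltW.
split; first by apply/normal_bundleP; split => //; exists (ratr r).
apply: (@lt_le_trans _ _ (ratr r)%:E); first by rewrite lte_fin.
by apply: ereal_sup_ubound; exists (ratr r) => //; split => //; exact: ltW.
Qed.

Lemma normal_bundle_reach : normal_bundle A = reach_gt 0.
Proof.
apply/seteqP; split => p; last by move=> /(reach_gtP _ (lexx _))[].
move=> pN; apply/reach_gtP => //; split => //.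
have [Ap p1 [s s0 sp]] := (normal_bundleP p).1 pN.
apply: (@lt_le_trans _ _ s%:E); first by rewrite lte_fin.
by apply: ereal_sup_ubound; exists s => //; split => //; exact: ltW.
Qed.

End normal_bundle.

(** * Borel measurability *)

Section borel_rV_functions.
Context (R : realType) (d : nat).

Lemma open_rV_bigcup_ball (U : set 'rV[R]_d) : open U ->
  let B := fun q : 'rV[rat]_d * nat =>
    ball (map_mx ratr q.1 : 'rV[R]_d) q.2.+1%:R^-1 in
  U = \bigcup_(q in [set q | B q `<=` U]) B q.
Proof.
move=> oU B; apply/seteqP; split => [x Ux|x [q qU qx]]; last exact: qU.
have /nbhs_ballP[e /= e0 eU] : nbhs x U by exact: open_nbhs_nbhs.
have [k ke] : exists k, 2 * k.+1%:R^-1 < e.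
  exists (Num.truncn (2 / e)).
  by rewrite ltr_pdivrMr// mulrC -ltr_pdivrMr// real_truncnS_gt// num_real.
have k0 : 0 < k.+1%:R^-1 :> R by rewrite invr_gt0.
have {}ke : k.+1%:R^-1 + k.+1%:R^-1 <= e.
  by move/ltW: ke; rewrite (mulr_natl _ 2) mulr2n.
have rat_close (y : R) : exists q : rat, `|ratr q - y| < k.+1%:R^-1.
  have : y - k.+1%:R^-1 < y + k.+1%:R^-1 by rewrite ltrD2l gtrN.
  move=> /rat_in_itvoo[q]; rewrite in_itv/= => yq; exists q.
  by rewrite ltr_distl.
have /choice[v vx] := fun i => rat_close (x ord0 i).
exists (\row_i v i, k); last first.
  by split => // i j; rewrite !mxE ord1; exact: vx.
move=> y [_ xy]; apply: eU; split => // i j; apply: (le_ball ke).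
apply: ball_triangle (xy i j); apply/ball_sym.
by rewrite !mxE ord1; exact: vx.
Qed.

(** Sup-norm balls are products of intervals, and every open set is a countable union of them. *)
Lemma measurable_fun_rV d0 (T : measurableType d0) (D : set T)
    (f : T -> 'rV[R]_d) :
  (forall j, measurable_fun D (fun x => f x ord0 j)) -> measurable_fun D f.
Proof.
move=> mf mD; apply: (measurability (@open 'rV[R]_d)) => // _ [U oU <-].
rewrite (open_rV_bigcup_ball oU) preimage_bigcup setI_bigcupr bigcup_mkcond.
apply: countable_bigcupT_measurable => // q; case: ifPn => // _.
set c := map_mx _ _; set e := _^-1.
have e0 : 0 < e by rewrite invr_gt0.
have -> : f @^-1` ball c e =
    \bigcap_(j in [set: 'I_d]) ((fun x => f x ord0 j) @^-1` ball (c ord0 j) e).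
  apply/seteqP; split => [x [_ fx] j _|x fx]; first exact: fx.
  by split => // i j; rewrite !ord1; exact: fx.
have -> : D `&` \bigcap_(j in [set: 'I_d])
      ((fun x => f x ord0 j) @^-1` ball (c ord0 j) e) =
    D `&` \bigcap_(j in [set: 'I_d])
      (D `&` (fun x => f x ord0 j) @^-1` ball (c ord0 j) e).
  apply/seteqP; split => x [Dx fx]; split => // j jT; last by case: (fx j jT).
  by split => //; exact: fx.
apply: measurableI => //; apply: fin_bigcap_measurable => // j _.
by apply: mf => //; exact: measurable_ball.
Qed.

Lemma continuous_rV_measurable (f : 'rV[R]_d -> R) :
  continuous f -> measurable_fun setT f.
Proof.
move=> cf; apply: (measurability _ (RGenOpens.measurableE R)) => // _ [_ [a [b ->]] <-].
rewrite setTI; apply: open_rV_measurable; move/continuousP: cf; apply.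
exact: interval_open.
Qed.

Lemma coord_measurable j : measurable_fun setT (fun x : 'rV[R]_d => x ord0 j).
Proof. by apply: continuous_rV_measurable; exact: coord_continuous. Qed.

Lemma enorm_measurable : measurable_fun setT (@enorm R d).
Proof.
apply: continuous_rV_measurable; apply: enorm_lipschitz_continuous => x y.
exact: enorm_dist.
Qed.

Lemma dist_measurable (A : set 'rV[R]_d) : A !=set0 ->
  measurable_fun setT (dist A).
Proof.
by move=> A0; apply: continuous_rV_measurable; exact: dist_continuous.
Qed.

End borel_rV_functions.

Section measurability.
Context (R : realType) (d : nat) (A : set 'rV[R]_d).
Context (A_neq0 : A !=set0) (A_compact : compact A).

Lemma measurable_compact : measurable A.
Proof.
have -> : A = setT `&` dist A @^-1` [set 0].
  rewrite setTI; apply/seteqP; split => y /=; first exact: dist_mem.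
  exact: dist_eq0.
by apply: dist_measurable => //.
Qed.

Lemma measurable_parallel_set e : measurable (parallel_set A e).
Proof.
have -> : parallel_set A e = setT `&` dist A @^-1` [set` `]-oo, e]].
  by rewrite setTI; apply/seteqP; split => y /=; rewrite in_itv.
by apply: dist_measurable => //.
Qed.

Lemma ray_measurable (r : R) :
  measurable_fun setT (fun p : 'rV[R]_d * 'rV[R]_d => p.1 + r *: p.2).
Proof.
apply: measurable_fun_rV => j.
have -> : (fun p : 'rV[R]_d * 'rV[R]_d => (p.1 + r *: p.2) ord0 j) =
    (fun p : 'rV[R]_d * 'rV[R]_d => p.1 ord0 j) \+
    (fun p : 'rV[R]_d * 'rV[R]_d => r * p.2 ord0 j).
  by apply/funext => p; rewrite /= !mxE.
apply: measurable_funD; first exact: measurableT_comp (@coord_measurable _ _ j) _.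
apply: measurable_funM => //.
exact: measurableT_comp (@coord_measurable _ _ j) _.
Qed.

Lemma measurable_reach_gt t : measurable (reach_gt A t).
Proof.
have -> : reach_gt A t = \bigcup_(q in [set q : rat | t < ratr q])
    ([set p | A p.1] `&` [set p | enorm p.2 = 1] `&`
     [set p | dist A (p.1 + ratr q *: p.2) = ratr q]).
  apply/seteqP; split => p; first by move=> [Ap p1 [q tq dq]]; exists q.
  by move=> [q tq [[Ap p1] dq]]; split => //; exists q.
rewrite bigcup_mkcond; apply: countable_bigcupT_measurable => // q.
case: ifPn => // _; apply: measurableI; first apply: measurableI.
- rewrite [X in measurable X](_ : _ = setT `&` fst @^-1` A); last by rewrite setTI.
  by apply: measurable_fst => //; exact: measurable_compact.
- rewrite [X in measurable X](_ : _ = setT `&` (@enorm R d \o snd) @^-1` [set 1]);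
    last by rewrite setTI.
  by apply: measurableT_comp => //; exact: enorm_measurable.
- rewrite [X in measurable X](_ : _ =
    setT `&` (dist A \o (fun p => p.1 + ratr q *: p.2)) @^-1` [set ratr q]);
    last by rewrite setTI.
  by apply: measurableT_comp => //; [exact: dist_measurable|exact: ray_measurable].
Qed.

Definition nearest_in (C : set 'rV[R]_d) : set 'rV[R]_d :=
  [set y | exists2 a, A a /\ C a & enorm (y - a) = dist A y].

(** When A meets C, the minimum over the compact set A [&] C is attained, so this is the zero set of
    a difference of two continuous distance functions. The empty intersection is separated because
    [dist] takes a junk value there. *)
Lemma measurable_nearest_in C : closed C -> measurable (nearest_in C).
Proof.
move=> cC; have [AC|/set0P AC] := eqVneq (A `&` C) set0.
  rewrite (_ : nearest_in C = set0)//; apply/seteqP; split => // y [a aAC _].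
  by have : (A `&` C) a by []; rewrite AC.
have -> : nearest_in C =
    setT `&` (fun y => dist (A `&` C) y - dist A y) @^-1` [set 0].
  rewrite setTI; apply/seteqP; split => y /=.
    move=> [a [Aa Ca] ya]; apply/eqP; rewrite subr_eq0 eq_le; apply/andP; split.
      by rewrite -ya dist_le_enorm.
    by apply: dist_ge => // b [Ab _]; exact: dist_le_enorm.
  move/eqP; rewrite subr_eq0 => /eqP yAC.
  have [a [Aa Ca] ya] := dist_attained AC (compact_closedI A_compact cC) y.
  by exists a => //; rewrite ya.
have : measurable_fun setT (fun y => dist (A `&` C) y - dist A y).
  by apply: measurable_funB; exact: dist_measurable.
exact.
Qed.

(** Two distinct nearest points differ in some coordinate, where two rationals separate them.
    Non-uniqueness is thus a countable union, over a coordinate and a pair of rationals, of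
    conditions of the form [nearest_in]. *)
Lemma measurable_Unp : measurable (Unp A).
Proof.
pose halves (q : 'I_d * rat * rat) :=
  nearest_in [set a | a ord0 q.1.1 <= ratr q.1.2] `&`
  nearest_in [set a | ratr q.2 <= a ord0 q.1.1].
have -> : Unp A = ~` A `\` \bigcup_(q in [set q : 'I_d * rat * rat | q.1.2 < q.2]) halves q.
  apply/seteqP; split => y.
    move=> [nAy [x yx]]; split => // -[[[j q1] q2] /= q12 [[a [Aa aq] ya] [b [Ab bq] yb]]].
    have xa : a = x.
      by have : nearest A y a by []; rewrite yx.
    have xb : b = x.
      by have : nearest A y b by []; rewrite yx.
    have : ratr q1 < ratr q2 :> R by rewrite ltr_rat.
    by move: aq bq; rewrite /= xa xb; lra.
  move=> [nAy nq]; split => //; have [x Ax yx] := dist_attained A_neq0 A_compact y.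
  exists x; apply: metric_projP => // a Aa ya; apply/rowP => j.
  apply/eqP; apply/negPn/negP => axj; apply: nq.
  wlog axj' : a x Aa Ax ya yx axj / a ord0 j < x ord0 j => [h|].
    have ya' : enorm (y - a) = dist A y.
      by apply/eqP; rewrite eq_le dist_le_enorm// andbT -yx.
    move: (axj); rewrite neq_lt => /orP[|] axj'; first exact: (h a x).
    by apply: (h x a) => //; rewrite ?yx ?ya'// eq_sym.
  have [q1] := rat_in_itvoo axj'; rewrite in_itv/= => /andP[aq1 q1x].
  have [q2] := rat_in_itvoo q1x; rewrite in_itv/= => /andP[q1q2 q2x].
  exists (j, q1, q2) => /=; first by rewrite ltr_rat in q1q2.
  split; [exists a|exists x] => //.
  - by split => //=; exact: ltW.
  - by apply/eqP; rewrite eq_le dist_le_enorm// andbT -yx.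
  - by split => //=; exact: ltW.
apply: measurableD; first by apply: measurableC; exact: measurable_compact.
rewrite bigcup_mkcond; apply: countable_bigcupT_measurable => // q.
case: ifPn => // _; apply: measurableI; apply: measurable_nearest_in.
- apply: (@preimage_closed _ _ (fun a : 'rV[R]_d => a ord0 q.1.1) [set z | z <= ratr q.1.2]).
    by move=> x _; exact: coord_continuous.
  exact: closed_le.
- apply: (@preimage_closed _ _ (fun a : 'rV[R]_d => a ord0 q.1.1) [set z | ratr q.2 <= z]).
    by move=> x _; exact: coord_continuous.
  exact: closed_ge.
Qed.

Definition projection (y : 'rV[R]_d) : 'rV[R]_d :=
  xget 0 [set x | ~ A y /\ metric_proj A y x].

Lemma projectionE y x : ~ A y -> metric_proj A y x -> projection y = x.
Proof.
move=> nAy yx; apply: xget_unique => [//|z [_ yz]].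
exact: metric_proj_inj yz yx.
Qed.

Lemma projection_out y : ~ Unp A y -> projection y = 0.
Proof. by move=> nU; apply: xgetPN => x [nAy yx]; apply: nU; split => //; exists x. Qed.

Lemma projection_measurable : measurable_fun setT projection.
Proof.
apply: measurable_fun_rV => j _.
apply: (measurability _ (RGenCInfty.measurableE R)) => // _ [_ [x ->] <-].
(* The second piece accounts for the default value 0 of [projection] off [Unp A]. *)
rewrite (_ : _ `&` _ = (Unp A `&` nearest_in [set a | x <= a ord0 j]) `|`
    (if x <= 0 then ~` Unp A else set0)).
  apply: measurableU.
    apply: measurableI; first exact: measurable_Unp.
    apply: measurable_nearest_in.
    apply: (@preimage_closed _ _ (fun a : 'rV[R]_d => a ord0 j) [set z | x <= z]).
      by move=> z _; exact: coord_continuous.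
    exact: closed_ge.
  by case: ifPn => // _; apply: measurableC; exact: measurable_Unp.
rewrite setTI; apply/seteqP; split => y.
  have [Uy|nUy] := pselect (Unp A y); last first.
    by rewrite /= projection_out// mxE in_itv/= andbT => ->; right.
  have [nAy [z yz]] := Uy.
  rewrite /= in_itv/= andbT (projectionE nAy yz) => xz; left; split => //.
  exists z; last exact: metric_proj_dist yz.
  by split => //; exact: metric_proj_mem yz.
move=> [[[nAy [z yz]] [a [Aa xa] ya]]|].
  have za : a = z by have : nearest A y a by []; rewrite yz.
  by rewrite /= in_itv/= andbT (projectionE nAy yz) -za.
case: ifPn => // x0 nUy; by rewrite /= projection_out// mxE in_itv/= andbT.
Qed.

(** Inverts (x, u) |-> x + t u on N_t, see [normal_coordE]. Its measurability makes the set swept by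
    a Borel set of normals Borel. *)
Definition normal_coord (y : 'rV[R]_d) : 'rV[R]_d * 'rV[R]_d :=
  (projection y, (dist A y)^-1 *: (y - projection y)).

Lemma normal_coord_measurable : measurable_fun setT normal_coord.
Proof.
have coordp j : measurable_fun setT (fun y => projection y ord0 j).
  exact: (measurableT_comp (@coord_measurable _ _ j) projection_measurable).
apply: measurable_fun_pair; first exact: projection_measurable.
apply: measurable_fun_rV => j.
have -> : (fun y : 'rV[R]_d => ((dist A y)^-1 *: (y - projection y)) ord0 j) =
    (fun y => (dist A y) `^ (-1)) \*
    (fun y : 'rV[R]_d => y ord0 j - projection y ord0 j).
  by apply/funext => y; rewrite /= !mxE powR_inv1 ?dist_ge0.
apply: measurable_funM.
  by apply: (measurableT_comp (measurable_powR _)); exact: dist_measurable.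
by apply: measurable_funB; [exact: coord_measurable|exact: coordp].
Qed.

Lemma normal_coordE t p : 0 < t -> reach_gt A t p ->
  normal_coord (p.1 + t *: p.2) = p.
Proof.
move=> t0 pt; have tt : 0 <= t <= t by rewrite lexx ltW.
have dt := reach_gt_dist A_neq0 A_compact pt tt.
have nA : ~ A (p.1 + t *: p.2) by apply/dist_gt0 => //; rewrite dt.
rewrite /normal_coord (projectionE nA (reach_gt_proj A_neq0 A_compact pt tt)) dt.
by rewrite [_ + _ - _]addrC addKr scalerA mulVf ?gt_eqF// scale1r; case: (p).
Qed.

End measurability.

(** * The Steiner formula for sets *)

Section lower_integral.
Local Open Scope ereal_scope.
Context d (T : measurableType d) (R : realType).
Variables (mu : {measure set T -> \bar R}) (D : set T).

(* The integral of a nonnegative function is a supremum over simple functions, *)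
(* hence monotone also on non-measurable functions.                            *)
Lemma le_integral_ge0 (f g : T -> \bar R) :
  (forall x, D x -> 0 <= f x) -> (forall x, D x -> f x <= g x) ->
  \int[mu]_(x in D) f x <= \int[mu]_(x in D) g x.
Proof.
move=> f0 fg; rewrite !ge0_integralE//; last first.
  by move=> x Dx; exact: le_trans (f0 _ Dx) (fg _ Dx).
apply: le_ereal_sup => _ [h hf <-]; exists h => // x.
apply: (le_trans (hf x)); rewrite /patch; case: ifPn => // /set_mem; exact: fg.
Qed.

(** The integrals of the positive and negative parts both lie between 0 and that of g, hence so does
    the absolute value of their difference. No measurability of f is assumed, which suits integrands
    such as t |-> mu_i(E t). *)
Lemma abse_integral_le (f g : T -> \bar R) :
  (forall x, D x -> `|f x| <= g x) ->
  `|\int[mu]_(x in D) f x| <= \int[mu]_(x in D) g x.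
Proof.
move=> fg; rewrite integralE.
have fp : \int[mu]_(x in D) f^\+ x <= \int[mu]_(x in D) g x.
  apply: le_integral_ge0 => x Dx; first exact: funepos_ge0.
  by rewrite funeposE ge_max (le_trans (lee_abs _) (fg _ Dx))
    (le_trans (abse_ge0 _) (fg _ Dx)).
have fn : \int[mu]_(x in D) f^\- x <= \int[mu]_(x in D) g x.
  apply: le_integral_ge0 => x Dx; first exact: funeneg_ge0.
  rewrite funenegE ge_max (le_trans (abse_ge0 _) (fg _ Dx)) andbT.
  by rewrite (le_trans _ (fg _ Dx))// -abseN lee_abs.
have p0 : 0 <= \int[mu]_(x in D) f^\+ x by apply: integral_ge0.
have n0 : 0 <= \int[mu]_(x in D) f^\- x by apply: integral_ge0.
move: fp fn p0 n0.
case: (\int[mu]_(x in D) g x) => [c||]; last 2 first.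
- by move=> *; rewrite leey.
- by move=> h1 _ h2; have := le_trans h2 h1.
case: (\int[mu]_(x in D) f^\+ x) => [a||]//.
case: (\int[mu]_(x in D) f^\- x) => [b||]//.
by rewrite !lee_fin ler_norml => *; apply/andP; split; lra.
Qed.

End lower_integral.

Section parallel_set_compact.
Context (R : realType) (d : nat) (A : set 'rV[R]_d).
Context (A_neq0 : A !=set0) (A_compact : compact A).

Lemma compact_parallel_set e : compact (parallel_set A e).
Proof.
have enormc : continuous (@enorm R d).
  by apply: enorm_lipschitz_continuous => x y; exact: enorm_dist.
have [c _ hc] := EVT_max_rV A_neq0 A_compact (continuous_subspaceT enormc).
apply: bounded_closed_compact.
  exists (enorm c + e); split => [|M cM y ye]; first exact: num_real.
  apply: (le_trans (norm_le_enorm y)); apply: le_trans (ltW cM).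
  have [a Aa ya] := dist_attained A_neq0 A_compact y.
  rewrite -(subrK a y); apply: (le_trans (enormD _ _)).
  by rewrite ya addrC lerD// hc//; exact/mem_set.
apply: (@preimage_closed _ _ (dist A) [set z | z <= e]); last exact: closed_le.
by move=> x _; exact: dist_continuous.
Qed.

End parallel_set_compact.

Section steiner.
Context (R : realType) (d : nat) (A : set 'rV[R]_d).
Context (A_neq0 : A !=set0) (A_compact : compact A).
Context (mu : 'I_d -> signed_measure ('rV[R]_d * 'rV[R]_d)%type R).
Context (hmu : support_measures A mu).
Implicit Types (r s t : R) (i : 'I_d).

Local Notation N := (normal_bundle A).
Local Notation var i := (variation_measure (mu i)).

Lemma variationE i B : var i B = (pos_part (mu i) B + neg_part (mu i) B)%E.
Proof. exact: measure_addE. Qed.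

Lemma measurable_normal_bundle : measurable N.
Proof. by rewrite normal_bundle_reach//; exact: measurable_reach_gt. Qed.

Lemma indic_reach t p : 0 <= t -> N p ->
  \1_[set q | (t%:E < local_reach A q)%E] p = \1_(reach_gt A t) p :> R.
Proof.
move=> t0 Np; rewrite !indicE; congr (_%:R); congr nat_of_bool.
by apply/idP/idP => /set_mem h; apply/mem_set; [apply/reach_gtP|
  case/reach_gtP : h].
Qed.

Lemma beta_varE i t : 0 <= t -> beta_var A (mu i) t = var i (reach_gt A t).
Proof.
move=> t0; rewrite /beta_var.
rewrite (eq_integral (fun p => (\1_(reach_gt A t) p)%:E)); last first.
  by move=> p /set_mem Np; rewrite indic_reach.
rewrite integral_indic; [|exact: measurable_normal_bundle|exact: measurable_reach_gt].
congr (var i _); apply/setIidPl.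
by rewrite normal_bundle_reach//; exact: reach_gt_sub.
Qed.

Lemma integral_scaled_indic (m : {measure set ('rV[R]_d * 'rV[R]_d) -> \bar R})
    c E : 0 <= c -> measurable E -> E `<=` N ->
  (\int[m]_(p in N) (c * \1_E p)%:E = c%:E * m E)%E.
Proof.
move=> c0 mE EN; rewrite (integralZl_indic measurable_normal_bundle (fun=> E))//.
  by rewrite integral_indic//; [rewrite (setIidPl _ _).2|exact: measurable_normal_bundle].
by rewrite ltNge c0.
Qed.

Lemma reach_sub_bundle t : 0 <= t -> reach_gt A t `<=` N.
Proof. by move=> t0; rewrite normal_bundle_reach//; exact: reach_gt_sub. Qed.

(** Take B = A and r = t in the integrability condition: on N_t the foot point lies in A and the
    local reach exceeds t, so the integrand equals t^(d-i). *)
Lemma variation_reach_lty i t : 0 < t -> (var i (reach_gt A t) < +oo)%E.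
Proof.
move=> t0; have [_ /(_ i A t A_compact t0) hfin _] := hmu.
have tk0 : 0 < t ^+ (d - i) by rewrite exprn_gt0.
have : ((t ^+ (d - i))%:E * var i (reach_gt A t) < +oo)%E.
  apply: le_lt_trans hfin.
  rewrite -integral_scaled_indic; [|exact: ltW| |exact/reach_sub_bundle/ltW];
    last exact: measurable_reach_gt.
  apply: le_integral_ge0 => p Np.
    by rewrite lee_fin mulr_ge0// ltW.
  have [pt|npt] := pselect (reach_gt A t p).
    have [Ap _ _] := pt.
    rewrite !indicE !mem_set// mulr1 mul1e EFin_expe.
    rewrite (min_idPl _)//.
    by have [_ /ltW] := (reach_gtP A_neq0 A_compact p (ltW t0)).2 pt.
  rewrite [\1_(reach_gt A t) p]indicE memNset// mulr0.
  rewrite mule_ge0 ?lee_fin// expe_ge0// le_min lee_fin (ltW t0)/=.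
  move: Np; rewrite normal_bundle_reach// => p0.
  by have [_ /ltW] := (reach_gtP A_neq0 A_compact p (lexx 0)).2 p0.
have := measure_ge0 (var i) (reach_gt A t).
case: (var i (reach_gt A t)) => [r _ _||//]; first by rewrite ltry.
by rewrite gt0_muley ?lte_fin.
Qed.

Lemma parts_le_variation i B :
  (pos_part (mu i) B <= var i B)%E /\ (neg_part (mu i) B <= var i B)%E.
Proof. by rewrite variationE leeDl ?measure_ge0// leeDr ?measure_ge0. Qed.

Lemma parts_fin_num i t B : 0 < t -> measurable B -> B `<=` reach_gt A t ->
  pos_part (mu i) B \is a fin_num /\ neg_part (mu i) B \is a fin_num.
Proof.
move=> t0 mB Bt; have [hp hn] := parts_le_variation i B.
have vB : (var i B < +oo)%E.
  apply: le_lt_trans (variation_reach_lty i t0); apply: le_measure => //;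
  by rewrite inE//; exact: measurable_reach_gt.
by split; rewrite ge0_fin_numE ?measure_ge0//; apply: le_lt_trans vB.
Qed.

(* E t collects the normals (x, u) whose point at distance t lies in G.        *)
Lemma steiner_set (G : set 'rV[R]_d) (E : R -> set ('rV[R]_d * 'rV[R]_d)) e :
  measurable G -> G `<=` ~` A -> G `<=` parallel_set A e ->
  (forall t, measurable (E t)) -> (forall t, 0 < t -> E t `<=` reach_gt A t) ->
  (forall t p, 0 < t -> reach_gt A t p -> G (p.1 + t *: p.2) <-> E t p) ->
  (lebesgue_rV G = \sum_(i < d) (omega R (d - i))%:E *
    \int[lebesgue_measure]_(t in `]0%R, +oo[)
      ((t ^+ (d - i - 1))%:E *
       (pos_part (mu i) (E t) - neg_part (mu i) (E t))))%E.
Proof.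
move=> mG GA Ge mE Et GE; have [_ _ hst] := hmu.
have := hst \1_G; rewrite integral_indic//; last first.
  by apply: measurableC; exact: measurable_compact.
rewrite (setIidPl _ _).2// => ->; last 3 first.
- exact: measurable_indic.
- by exists 1 => x; rewrite indicE; case: (_ \in _); rewrite ?normr1 ?normr0.
- apply: (@subclosed_compact _ _ (parallel_set A e)); first exact: closed_closure.
    exact: compact_parallel_set.
  have cP : closed (parallel_set A e).
    apply: (@preimage_closed _ _ (dist A) [set z | z <= e]); last exact: closed_le.
    by move=> x _; exact: dist_continuous.
  rewrite [X in _ `<=` X](_ : _ = closure (parallel_set A e)); last exact/closure_id.
  apply: closure_subset => x /=; rewrite indicE; case: (boolP (x \in G)).
    by move=> /set_mem /Ge.
  by rewrite eqxx.
apply: eq_bigr => i _; congr (_ * _)%E; apply: eq_integral => t /set_mem /=.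
rewrite in_itv/= andbT => t0; rewrite /signed_integral.
have tk : 0 <= t ^+ (d - i - 1) by rewrite exprn_ge0// ltW.
(* On N_t the two indicators agree by [GE]; off N_t both sides vanish because E t lies in N_t. *)
have h p : p \in N -> (t ^+ (d - i - 1) *
    \1_[set q | (t%:E < local_reach A q)%E] p * \1_G (p.1 + t *: p.2))%:E =
    (t ^+ (d - i - 1) * \1_(E t) p)%:E.
  move=> /set_mem Np; rewrite indic_reach ?ltW//; congr (_%:E).
  rewrite -mulrA; congr (_ * _).
  have [pt|npt] := pselect (reach_gt A t p).
    rewrite [\1_(reach_gt A t) p]indicE mem_set// mul1r !indicE.
    congr (_%:R); congr nat_of_bool; apply/idP/idP => /set_mem hp; apply/mem_set;
    exact/(GE t p t0 pt).
  rewrite [\1_(reach_gt A t) p]indicE memNset// mul0r indicE memNset//.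
  by move=> /(Et _ t0).
have EN : E t `<=` N.
  by apply: (subset_trans (Et _ t0)); exact/reach_sub_bundle/ltW.
rewrite !(eq_integral _ _ h) !integral_scaled_indic//.
have [pf nf] := parts_fin_num i t0 (mE t) (Et _ t0).
by rewrite muleBr// fin_num_adde_defl// fin_numN.
Qed.

End steiner.

Section shell_bound.
Context (R : realType) (d : nat) (A : set 'rV[R]_d).
Context (A_neq0 : A !=set0) (A_compact : compact A).
Context (mu : 'I_d -> signed_measure ('rV[R]_d * 'rV[R]_d)%type R).
Context (hmu : support_measures A mu).
Implicit Types (r s t : R) (i : 'I_d).

Local Notation var i := (variation_measure (mu i)).

Lemma abse_parts_le i B :
  (`|pos_part (mu i) B - neg_part (mu i) B| <= var i B)%E.
Proof.
rewrite variationE; apply: (le_trans (lee_abs_sub _ _)).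
by rewrite !gee0_abs ?measure_ge0.
Qed.

(** Only radii t in ]s, T] contribute, each through mu_i(N_t), and N_t lies in N_s. So the i-th
    integral is at most T^(d-i-1) |mu_i|(N_s) times an interval length bounded by T. *)
Lemma shell_volume_le s T : 0 < s -> s <= T ->
  (lebesgue_rV (parallel_set A T `\` parallel_set A s) <=
   \sum_(i < d) (`|omega R (d - i)| * T ^+ (d - i))%:E *
     var i (reach_gt A s))%E.
Proof.
move=> s0 sT; have T0 : 0 < T by exact: lt_le_trans sT.
pose E t := if s < t <= T then reach_gt A t else set0.
have mE t : measurable (E t).
  by rewrite /E; case: ifPn => // _; exact: measurable_reach_gt.
have Et t : E t `<=` reach_gt A t by rewrite /E; case: ifPn => // _ p [].
rewrite (steiner_set A_neq0 A_compact hmu (E := E) (e := T)) //; last 3 first.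
- by apply: measurableD; exact: measurable_parallel_set.
- move=> y [_ ys] Ay; apply: ys; rewrite /parallel_set/= dist_mem//; exact: ltW.
- move=> t p t0 pt; rewrite /parallel_set/= (reach_gt_dist A_neq0 A_compact pt);
    last by rewrite lexx ltW.
  rewrite /E; split=> [[tT /negP]|]; first by rewrite -ltNge => ->; rewrite tT.
  by case: ifPn => // /andP[st ->] _; split => //; apply/negP; rewrite -ltNge.
apply: (le_trans (lee_abs _)); apply: (le_trans (lee_abs_sum _ _ _)).
apply: lee_sum => i _; rewrite abseM/= EFinM -muleA lee_wpmul2l ?lee_fin//.
have vfin := variation_reach_lty A_neq0 A_compact hmu i s0.
pose K := T ^+ (d - i - 1) * fine (var i (reach_gt A s)).
have K0 : 0 <= K by rewrite mulr_ge0 ?exprn_ge0 ?fine_ge0 ?measure_ge0// ltW.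
apply: (@le_trans _ _ (\int[lebesgue_measure]_(t in `]0%R, +oo[)
    (K * \1_`]s, T] t)%:E)%E).
  apply: abse_integral_le => t /=; rewrite in_itv/= andbT => t0.
  rewrite /E indicE mem_setE in_itv/=; case: ifPn => [/andP[st tT]|_]; last first.
    by rewrite !measure0 subee// mule0 abse0 mulr0.
  rewrite mulr1 abseM /K EFinM fineK ?ge0_fin_numE//.
  apply: lee_pmul => //.
    rewrite /= lee_fin ger0_norm ?exprn_ge0 ?(ltW t0)//.
    by rewrite lerXn2r ?nnegrE ?(ltW t0) ?(ltW T0).
  apply: (le_trans (abse_parts_le _ _)); apply: le_measure; rewrite ?inE.
  - exact: measurable_reach_gt.
  - exact: measurable_reach_gt.
  - by apply: reach_gt_sub; exact: ltW.
under eq_integral do rewrite EFinM.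
rewrite ge0_integralZl//; last by apply/measurable_EFinP; exact: measurable_indic.
rewrite integral_indic//.
apply: (@le_trans _ _ (K%:E * T%:E)%E).
  rewrite lee_wpmul2l ?lee_fin//.
  apply: (@le_trans _ _ (lebesgue_measure (`]s, T] : set R))).
    by apply: le_measure; rewrite ?inE//; exact: measurableI.
  rewrite lebesgue_measure_itv/= lte_fin; case: ifPn => _; last by rewrite lee_fin ltW.
  by rewrite lee_fin lerBlDr lerDl ltW.
rewrite -EFinM -{1}(fineK (_ : var i (reach_gt A s) \is a fin_num)) ?ge0_fin_numE//.
rewrite -EFinM lee_fin /K mulrAC -exprSr.
by rewrite subn1 prednK// subn_gt0.
Qed.

End shell_bound.

(** * Bounding the support measures by parallel volumes *)

(* Invert the Vandermonde matrix of the points t j / n, 1 <= j <= n.           *)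
Lemma polynomial_coef_bound (R : realType) (n : nat) : exists2 C : R, 0 <= C &
  forall (a : 'I_n -> R) (M t : R), 0 < t ->
    (forall s, 0 < s <= t -> `|\sum_(k < n) a k * s ^+ k.+1| <= M) ->
    forall k, `|a k| * t ^+ k.+1 <= C * M.
Proof.
pose x : 'rV[R]_n := \row_(j < n) (j.+1%:R / n%:R).
have x0 (j : 'I_n) : 0 < x ord0 j.
  by rewrite mxE divr_gt0 ?ltr0n// (leq_ltn_trans _ (ltn_ord j)).
(* The diagonal factor raises every power by one: the polynomials have no constant term. *)
pose V := Vandermonde n x *m diag_mx x.
have Vu : V \in unitmx.
  rewrite unitmxE det_mulmx det_Vandermonde det_diag unitfE mulf_neq0//.
    apply/prodf_neq0 => i _; apply/prodf_neq0 => j ij; rewrite !mxE -mulrBl.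
    rewrite mulf_neq0 ?subr_eq0 ?eqr_nat ?gt_eqF//.
    by rewrite invr_gt0 ltr0n (leq_ltn_trans _ (ltn_ord i)).
  by apply/prodf_neq0 => j _; rewrite gt_eqF.
exists (\sum_(j < n) \sum_(k < n) `|invmx V j k|).
  by apply: sumr_ge0 => j _; apply: sumr_ge0.
move=> a M t t0 h k.
pose b : 'rV[R]_n := \row_(k < n) (a k * t ^+ k.+1).
have bV j : (b *m V) ord0 j = \sum_(k < n) a k * (t * x ord0 j) ^+ k.+1.
  rewrite mulmxA mul_mx_diag mxE mxE mulr_suml; apply: eq_bigr => l _.
  by rewrite !mxE [in RHS]exprMn [in RHS](exprSr (_ / _)) !mulrA.
have bVM j : `|(b *m V) ord0 j| <= M.
  rewrite bV; apply: h; rewrite mulr_gt0//= ger_pMr// mxE.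
  by rewrite ler_pdivrMr ?mul1r ?ler_nat// ltr0n (leq_ltn_trans _ (ltn_ord j)).
have -> : `|a k| * t ^+ k.+1 = `|b ord0 k|.
  by rewrite mxE normrM (ger0_norm (exprn_ge0 _ (ltW t0))).
rewrite -[b](mulmxK Vu) mxE; apply: (le_trans (ler_norm_sum _ _ _)).
rewrite mulr_suml; apply: ler_sum => j _; rewrite normrM mulrC.
apply: ler_pM => //; rewrite (bigD1 k)//= lerDl.
by apply: sumr_ge0.
Qed.

(** * Positivity of the constants omega_k *)

Section omega_gt0.
Variable R : realType.

(** Since exp(t/2) dominates the powers of t, the integrand is at most a multiple of the exponential
    density of rate 1/2, whose integral is 1. *)
Lemma Gamma_integrand_le (s t : R) (n : nat) : 1 <= s -> s - 1 <= n.+1%:R -> 0 < t ->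
  t `^ (s - 1) * expR (- t) <=
  2 * (1 + 2 ^+ n.+1 * n.+1`!%:R) * exponential_pdf 2^-1 t.
Proof.
move=> s1 sn t0; rewrite exponential_pdfE ?(ltW t0)//.
have -> : 2 * (1 + 2 ^+ n.+1 * n.+1`!%:R) * (2^-1 * expR (- 2^-1 * t)) =
   (1 + 2 ^+ n.+1 * n.+1`!%:R) * expR (t / 2) * expR (- t) :> R.
  have -> : - 2^-1 * t = t / 2 - t by field.
  by rewrite expRD; field.
rewrite ler_wpM2r ?expR_ge0//.
have t2 : 0 <= t / 2 by rewrite divr_ge0// ltW.
have h1 := expR_ge1Dxn n t2.
have f0 : 0 < n.+1`!%:R :> R by rewrite ltr0n fact_gt0.
have h2 : t ^+ n.+1 <= 2 ^+ n.+1 * n.+1`!%:R * expR (t / 2).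
  have -> : t ^+ n.+1 = 2 ^+ n.+1 * n.+1`!%:R * ((t / 2) ^+ n.+1 / n.+1`!%:R).
    by rewrite expr_div_n; field; rewrite !gt_eqF// exprn_gt0.
  rewrite ler_wpM2l ?mulr_ge0 ?exprn_ge0 ?(ltW f0)//.
  by apply: le_trans h1; rewrite lerDr.
have h3 : 1 <= expR (t / 2) by rewrite -[X in X <= _]expR0 ler_expR.
rewrite mulrDl mul1r; have [t1|t1] := leP t 1.
  apply: (@le_trans _ _ 1); last first.
    by rewrite (le_trans h3)// lerDl (le_trans _ h2)// exprn_ge0// ltW.
  by rewrite -[X in _ <= X](powRr0 t) ger_powR ?t0 ?t1// subr_ge0.
apply: (@le_trans _ _ (t ^+ n.+1)); last by rewrite (le_trans h2)// lerDr expR_ge0.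
by rewrite -powR_mulrn ?(ltW t0)// ler_powR// ltW.
Qed.

(** [Rintegral] would turn an infinite integral into 0, so finiteness has to be shown along with
    positivity. For the latter, the integrand is at least exp(-2) on [1, 2]. *)
Lemma Gamma_gt0 (s : R) : 1 <= s -> 0 < Gamma s.
Proof.
move=> s1; pose n := Num.truncn s.
have sn : s - 1 <= n.+1%:R.
  have := real_truncnS_gt (num_real s); rewrite -/n => /ltW h.
  by rewrite (le_trans _ h)// lerBlDr lerDl.
rewrite /Gamma /Rintegral; apply: fine_gt0; apply/andP; split.
  apply: (@lt_le_trans _ _ (\int[lebesgue_measure]_(t in `]0%R, +oo[)
      (expR (- 2) * \1_`[1%R, 2%R] t)%:E)%E).
    under eq_integral do rewrite EFinM.
    rewrite ge0_integralZl ?lee_fin ?expR_ge0//; last first.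
      by apply/measurable_EFinP; exact: measurable_indic.
    rewrite integral_indic// (setIidPl _ _).2; last first.
      move=> x /=; rewrite !in_itv/= => /andP[x1 _]; rewrite andbT.
      exact: lt_le_trans x1.
    rewrite mule_gt0 ?lte_fin ?expR_gt0//.
    change (0 < lebesgue_measure (`[1%R, 2%R]%classic : set R))%E.
    by rewrite lebesgue_measure_itv/= lte_fin ltr1n lte_fin subr_gt0 ltr1n.
  apply: le_integral_ge0 => t; rewrite /= in_itv/= andbT => t0.
    by rewrite lee_fin mulr_ge0 ?expR_ge0.
  rewrite lee_fin indicE mem_setE in_itv/=; case: (boolP (1 <= t <= 2)) => [/andP[t1 t2]|_]; last first.
    by rewrite mulr0 mulr_ge0 ?expR_ge0 ?powR_ge0.
  rewrite mulr1 -[X in X <= _]mul1r.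
  apply: ler_pM; rewrite ?expR_ge0 ?ler_expR ?lerN2//.
  by rewrite -[X in X <= _](powRr0 t) ler_powR// subr_ge0.
apply: (@le_lt_trans _ _ (\int[lebesgue_measure]_t
   ((2 * (1 + 2 ^+ n.+1 * n.+1`!%:R))%:E * (exponential_pdf 2^-1 t)%:E))%E).
  rewrite integral_mkcond; apply: le_integral_ge0 => t _; rewrite patchE.
    by case: ifPn => // _; rewrite lee_fin mulr_ge0 ?expR_ge0 ?powR_ge0.
  case: ifPn => [/set_mem|_]; last first.
    by rewrite -EFinM lee_fin mulr_ge0 ?exponential_pdf_ge0// ?addr_ge0 ?mulr_ge0 ?exprn_ge0.
  rewrite /= in_itv/= andbT => t0; rewrite -EFinM lee_fin.
  exact: Gamma_integrand_le.
rewrite ge0_integralZl//.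
- by rewrite integral_exponential_pdf// mule1 ltry.
- by apply/measurable_EFinP; exact: measurable_exponential_pdf.
- by move=> t _; rewrite lee_fin exponential_pdf_ge0.
Qed.

Lemma omega_gt0 (k : nat) : (0 < k)%N -> 0 < omega R k.
Proof.
move=> k0; rewrite mulr_gt0 ?ltr0n// divr_gt0//.
  by rewrite powR_gt0// pi_gt0.
by rewrite Gamma_gt0// lerDr divr_ge0.
Qed.

End omega_gt0.

Lemma integral_exprn (R : realType) (n : nat) (s : R) : 0 < s ->
  (\int[lebesgue_measure]_(r in `]0%R, +oo[) (r ^+ n * \1_`]0%R, s]%classic r)%:E =
   (s ^+ n.+1 / n.+1%:R)%:E)%E.
Proof.
move=> s0; pose F (r : R) := r ^+ n.+1 / n.+1%:R.
have X_d (x : R) : is_derive x 1 (fun r : R => r ^+ n.+1) (n.+1%:R *: x ^+ n).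
  by apply: DeriveDef; [exact: exprn_derivable|rewrite -derive1E exp_derive1].
have F_d (x : R) : is_derive x 1 F (x ^+ n).
  have -> : F = n.+1%:R^-1 *: (fun r : R => r ^+ n.+1).
    by apply/funext => r; rewrite /F mulrC.
  apply: is_derive_eq; rewrite /GRing.scale/= mulrA mulVf ?mul1r//.
have F_c : continuous F.
  by move=> x; apply: differentiable_continuous; apply/derivable1_diffP; case: (F_d x).
have := @continuous_FTC2 R (fun r => r ^+ n) F 0 s s0.
rewrite /F expr0n/= mul0r sube0 => <-; last 3 first.
- by apply: continuous_subspaceT => x; exact: exprn_continuous.
- split; [by move=> x _; case: (F_d x)| |].
    by apply: cvg_at_right_filter; exact: F_c.
  by apply: cvg_at_left_filter; exact: F_c.
- by move=> x _; rewrite derive1E; case: (F_d x).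
rewrite -integral_itv_obnd_cbnd; last first.
  by apply/measurable_EFinP; apply: measurable_funTS; exact: exprn_measurable.
rewrite integral_mkcond [RHS]integral_mkcond; apply: eq_integral => r _.
rewrite !patchE !mem_setE !in_itv/= andbT indicE mem_setE in_itv/=.
case: (ltP 0 r) => r0 //=; case: (r <= s); first by rewrite mulr1.
by rewrite mulr0.
Qed.

Section steiner_polynomial.
Context (R : realType) (d : nat) (A : set 'rV[R]_d).
Context (A_neq0 : A !=set0) (A_compact : compact A).
Context (mu : 'I_d -> signed_measure ('rV[R]_d * 'rV[R]_d)%type R).
Context (hmu : support_measures A mu).
Implicit Types (r s t : R) (i : 'I_d).

Local Notation var i := (variation_measure (mu i)).

(** This is mu_i(B) as long as both parts are finite on B, in particular for Borel B inside some N_t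
    with t > 0. *)
Definition signed_mass i B : R := fine (pos_part (mu i) B) - fine (neg_part (mu i) B).

Lemma compact_lebesgue_lty (K : set 'rV[R]_d) : measurable K -> compact K ->
  (lebesgue_rV K < +oo)%E.
Proof.
move=> mK /compact_bounded[M [_ hM]].
have [m [mE mfin]] := @lebesgue_rV_subproof R d.
have e0 : 0 < `|M| + 2 by rewrite ltr_wpDl.
apply: (le_lt_trans _ (mfin _ e0)); rewrite -mE; apply: le_measure; rewrite ?inE//; first exact: ball_rV_measurable.
move=> y Ky; rewrite mx_norm_ball /ball_/= sub0r normrN.
have M1 : M < `|M| + 1 by rewrite (le_lt_trans (ler_norm M))// ltrDl.
by apply: (le_lt_trans (hM _ M1 y Ky)); rewrite ltrD2l ltr1n.
Qed.

Lemma parallel_volume_lty t : (lebesgue_rV (parallel_set A t `\` A) < +oo)%E.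
Proof.
have mP := measurable_parallel_set A_neq0 t.
apply: (le_lt_trans _ (compact_lebesgue_lty mP (@compact_parallel_set _ _ _ A_neq0 A_compact t))).
apply: le_measure; rewrite ?inE//.
by apply: measurableD => //; exact: measurable_compact.
Qed.

(** The sum is the volume of the set swept out by the normals in B up to distance s, a subset of A_t
    \ A. *)
Lemma local_steiner_polynomial t s B : 0 < s <= t -> measurable B ->
  B `<=` reach_gt A t ->
  `|\sum_(i < d) omega R (d - i) / (d - i)%:R * signed_mass i B * s ^+ (d - i)|
  <= fine (lebesgue_rV (parallel_set A t `\` A)).
Proof.
move=> /andP[s0 st] mB Bt; have t0 : 0 < t by exact: lt_le_trans st.
(* The swept set, described through the inverse coordinates; inside [Unp A] these are not default
   values. *)
pose G := (~` A) `&` parallel_set A s `&` (@normal_coord R d A @^-1` B) `&` Unp A.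
have mG : measurable G.
  apply: measurableI; last exact: measurable_Unp.
  apply: measurableI.
    apply: measurableI; last exact: measurable_parallel_set.
    by apply: measurableC; exact: measurable_compact.
  by rewrite -[X in measurable X]setTI; apply: normal_coord_measurable.
pose E r := if r <= s then B else set0.
have := steiner_set A_neq0 A_compact hmu (G := G) (E := E) (e := s) mG.
have -> : (\sum_(i < d) (omega R (d - i))%:E *
    \int[lebesgue_measure]_(r in `]0%R, +oo[)
     ((r ^+ (d - i - 1))%:E * (pos_part (mu i) (E r) - neg_part (mu i) (E r))) =
   (\sum_(i < d) omega R (d - i) / (d - i)%:R * signed_mass i B * s ^+ (d - i))%:E)%E.
  rewrite -sumEFin; apply: eq_bigr => i _.
  have [pf nf] := parts_fin_num A_neq0 A_compact hmu i t0 mB Bt.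
  rewrite [X in (_ * X)%E](_ : _ = \int[lebesgue_measure]_(r in `]0%R, +oo[)
      ((signed_mass i B)%:E *
       (r ^+ (d - i - 1) * \1_`]0%R, s]%classic r)%:E))%E; last first.
    apply: eq_integral => r; rewrite inE/= in_itv/= andbT => r0.
    rewrite indicE mem_setE in_itv/= r0 /E; case: ifPn => _ /=.
      by rewrite mulr1 muleC /signed_mass EFinB !fineK.
    by rewrite !measure0 subee// mulr0 !mule0.
  have di : ((d - i - 1).+1 = d - i)%N by rewrite subn1 prednK// subn_gt0.
  have := integral_exprn (d - i - 1) s0; rewrite di => int_eq.
  rewrite integralZl//.
    by rewrite int_eq -!EFinM; congr (_%:E); rewrite !mulrA; ring.
  apply/integrableP; split.
    apply/measurable_EFinP; apply: measurable_funM.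
      by apply: measurable_funTS; exact: exprn_measurable.
    exact: measurable_indic.
  rewrite [X in (X < _)%E](_ : _ = \int[lebesgue_measure]_(r in `]0%R, +oo[)
      (r ^+ (d - i - 1) * \1_`]0%R, s]%classic r)%:E)%E.
    by rewrite int_eq ltry.
  apply: eq_integral => r; rewrite inE/= in_itv/= andbT => r0.
  by rewrite ger0_norm// mulr_ge0// exprn_ge0// ltW.
move=> GE; have {}GE := GE _ _ _ _ _.
have GV : lebesgue_rV G = (\sum_(i < d) omega R (d - i) / (d - i)%:R *
    signed_mass i B * s ^+ (d - i))%:E.
  apply: GE.
  - by move=> y [[[]]].
  - by move=> y [[[]]].
  - by move=> r; rewrite /E; case: ifPn.
  - move=> r r0; rewrite /E; case: ifPn => // rs.
    by apply: (subset_trans Bt); apply: reach_gt_sub; exact: le_trans st.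
  - move=> r p r0 pr.
    have rr : 0 <= r <= r by rewrite lexx ltW.
    have dr := reach_gt_dist A_neq0 A_compact pr rr.
    have nA : ~ A (p.1 + r *: p.2) by apply/dist_gt0 => //; rewrite dr.
    rewrite /G /E /= /parallel_set/= dr normal_coordE//; split.
      by move=> [[[_ ->]]].
    case: ifPn => // rs pB; split; first by [].
    by split => //; exists p.1; exact: (reach_gt_proj A_neq0 A_compact pr rr).
have <- : fine (lebesgue_rV G) = \sum_(i < d) omega R (d - i) / (d - i)%:R *
    signed_mass i B * s ^+ (d - i) by rewrite GV.
have Gt : G `<=` parallel_set A t `\` A.
  by move=> y [[[nA ys] _] _]; split => //; exact: le_trans st.
have mPt : measurable (parallel_set A t `\` A).
  by apply: measurableD; [exact: measurable_parallel_set|exact: measurable_compact].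
have Gle : (lebesgue_rV G <= lebesgue_rV (parallel_set A t `\` A))%E.
  by apply: le_measure; rewrite ?inE.
rewrite ger0_norm ?fine_ge0 ?measure_ge0// fine_le// ge0_fin_numE ?measure_ge0//.
  by apply: le_lt_trans Gle _; exact: parallel_volume_lty.
exact: parallel_volume_lty.
Qed.

End steiner_polynomial.

Section inverse_bound.
Context (R : realType) (d : nat) (A : set 'rV[R]_d).
Context (A_neq0 : A !=set0) (A_compact : compact A).
Context (mu : 'I_d -> signed_measure ('rV[R]_d * 'rV[R]_d)%type R).
Context (hmu : support_measures A mu).
Implicit Types (r s t : R) (i : 'I_d).

Local Notation var i := (variation_measure (mu i)).

Lemma signed_mass_bound : exists2 C : 'I_d -> R, (forall i, 0 <= C i) &
  forall i t B, 0 < t -> measurable B -> B `<=` reach_gt A t ->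
    `|signed_mass mu i B| <=
    C i / t ^+ (d - i) * fine (lebesgue_rV (parallel_set A t `\` A)).
Proof.
have [C C0 hC] := polynomial_coef_bound R d.
have w0 i : 0 < omega R (d - i) by rewrite omega_gt0// subn_gt0.
have di0 i : 0 < (d - i)%:R :> R by rewrite ltr0n subn_gt0.
exists (fun i => C * (d - i)%:R / omega R (d - i)) => [i|i t B t0 mB Bt].
  by rewrite divr_ge0 ?(ltW (w0 i))// mulr_ge0.
(* Reversed indexing: the coefficient of s^(k+1) belongs to the measure of index d - k - 1. *)
pose a (k : 'I_d) := omega R k.+1 / k.+1%:R * signed_mass mu (rev_ord k) B.
set v := fine _.
have drev (k : 'I_d) : (d - rev_ord k)%N = k.+1 by rewrite /= subKn.
have av s : 0 < s <= t -> `|\sum_(k < d) a k * s ^+ k.+1| <= v.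
  move=> st; rewrite [X in `|X|](_ : _ = \sum_(i < d)
    omega R (d - i) / (d - i)%:R * signed_mass mu i B * s ^+ (d - i)).
    exact: local_steiner_polynomial.
  rewrite [RHS](reindex_inj rev_ord_inj)/=.
  by apply: eq_bigr => k _; rewrite subKn.
have := hC a v t t0 av (rev_ord i).
have -> : (rev_ord i).+1 = (d - i)%N by rewrite -drev rev_ordK.
rewrite /a rev_ordK.
have -> : (rev_ord i).+1 = (d - i)%N by rewrite -drev rev_ordK.
rewrite normrM (ger0_norm (_ : 0 <= omega R (d - i) / (d - i)%:R)); last first.
  by rewrite divr_ge0// ltW.
move=> h; have tk : 0 < t ^+ (d - i) by rewrite exprn_gt0.
have -> : C * (d - i)%:R / omega R (d - i) / t ^+ (d - i) * v =
    C * v / (omega R (d - i) / (d - i)%:R * t ^+ (d - i)).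
  by field; rewrite !gt_eqF.
have wt : 0 < omega R (d - i) / (d - i)%:R * t ^+ (d - i).
  by rewrite (mulr_gt0 _ tk)// divr_gt0.
by rewrite ler_pdivlMr// mulrA (mulrC `|_|).
Qed.

Lemma variation_le_volume : exists2 C : 'I_d -> R, (forall i, 0 <= C i) &
  forall i t, 0 < t -> (var i (reach_gt A t) <=
    (C i / t ^+ (d - i))%:E * lebesgue_rV (parallel_set A t `\` A))%E.
Proof.
have [C C0 hC] := signed_mass_bound.
(* One [C i] for each side of the Hahn set P: mu_i is its positive part on P and minus its negative
   part off P. *)
exists (fun i => 2 * C i) => [i|i t t0]; first by rewrite mulr_ge0.
have [P [mP pP nP]] := parts_singular (mu i).
have mr := measurable_reach_gt A_neq0 A_compact t.
have h1 := hC i t _ t0 (measurableI _ _ mr mP) (@subIsetl _ _ _).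
have h2 := hC i t _ t0 (measurableD mr mP) (@subDsetl _ _ _).
have [p1 n1] := parts_fin_num A_neq0 A_compact hmu i t0
  (measurableI _ _ mr mP) (@subIsetl _ _ _).
have [p2 n2] := parts_fin_num A_neq0 A_compact hmu i t0
  (measurableD mr mP) (@subDsetl _ _ _).
have n1E : neg_part (mu i) (reach_gt A t `&` P) = 0%E.
  by apply: subset_measure0 nP => //; exact: measurableI.
have p2E : pos_part (mu i) (reach_gt A t `\` P) = 0%E.
  by apply: subset_measure0 pP => //; [exact: measurableD|exact: measurableC].
move: h1 h2; rewrite /signed_mass n1E p2E/= subr0 sub0r normrN.
rewrite !ger0_norm ?fine_ge0 ?measure_ge0// => h1 h2.
have vfin : lebesgue_rV (parallel_set A t `\` A) \is a fin_num.
  by rewrite ge0_fin_numE ?measure_ge0//; exact: parallel_volume_lty.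
rewrite variationE.
have -> : pos_part (mu i) (reach_gt A t) = pos_part (mu i) (reach_gt A t `&` P).
  apply: (etrans (measureDI _ mr mP)).
  by rewrite [X in (X + _)%E](_ : _ = 0%E) ?add0e.
have -> : neg_part (mu i) (reach_gt A t) = neg_part (mu i) (reach_gt A t `\` P).
  apply: (etrans (measureDI _ mr mP)).
  by rewrite [X in (_ + X)%E](_ : _ = 0%E) ?adde0.
rewrite -(fineK vfin) -(fineK p1) -(fineK n2) -EFinD -EFinM lee_fin.
by lra.
Qed.

End inverse_bound.

(** * Scaling exponents *)

Section limits_at_0.
Context (R : realType).
Implicit Types (f g : R -> \bar R) (P : set R).

Lemma at_right0P P :
  0^'+ P <-> exists2 s : R, 0 < s & forall t, 0 < t < s -> P t.
Proof.
split=> [|[s s0 sP]].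
  move=> /nbhs_ballP[s /= s0 sP]; exists s => // t /andP[t0 ts].
  by apply: sP => //; rewrite /ball/= sub0r normrN gtr0_norm.
near=> t; apply: sP; apply/andP; split; near: t; last exact: nbhs_right_lt.
exact: nbhs_right_gt.
Unshelve. all: by end_near. Qed.

Lemma limf_esup_eq0P f : (forall t, 0 <= f t)%E ->
  limf_esup f 0^'+ = 0%E <->
  forall e, 0 < e -> exists2 s : R, 0 < s &
    forall t, 0 < t < s -> (f t <= e%:E)%E.
Proof.
move=> f0; split=> [f_0 e e0|h].
  have : (limf_esup f 0^'+ < e%:E)%E by rewrite f_0 lte_fin.
  rewrite limf_esupE => /ereal_inf_lt[_ [V /at_right0P[s s0 sV] <-] Ve].
  exists s => // t ts; apply: le_trans (ltW Ve).
  by apply: ereal_sup_ubound; exists t => //; exact: sV.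
apply/eqP; rewrite eq_le; apply/andP; split; last first.
  apply: limf_esup_ge0 => //; exact: filter_not_empty.
apply/lee_addgt0Pr => e e0; rewrite add0e; have [s s0 sf] := h e e0.
rewrite limf_esupE; apply: ge_ereal_inf; eexists.
  by exists [set t | 0 < t < s] => //; apply/at_right0P; exists s.
by apply: ge_ereal_sup => _ [t ts <-]; exact: sf.
Qed.

Lemma limf_einf_eq0P f : (forall t, 0 <= f t)%E ->
  limf_einf f 0^'+ = 0%E <->
  forall e s : R, 0 < e -> 0 < s -> exists2 t, 0 < t < s & (f t <= e%:E)%E.
Proof.
move=> f0; rewrite limf_einfE; split=> [f_0 e s e0 s0|h].
  apply: contrapT => nt.
  have : (e%:E <= 0 :> \bar R)%E; last by rewrite lee_fin leNgt e0.
  rewrite -f_0; apply: le_ereal_sup_tmp; eexists.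
    by exists [set t | 0 < t < s] => //; apply/at_right0P; exists s.
  apply: le_ereal_inf_tmp => _ [t ts <-]; rewrite leNgt; apply/negP => /ltW ft.
  by apply: nt; exists t.
apply/eqP; rewrite eq_le; apply/andP; split.
  apply: ge_ereal_sup => _ [V /at_right0P[s s0 sV] <-].
  apply/lee_addgt0Pr => e e0; rewrite add0e; have [t ts ft] := h e s e0 s0.
  by apply: ge_ereal_inf; exists (f t) => //; exists t => //; exact: sV.
apply: le_ereal_sup_tmp; eexists.
  by exists setT => //; exact: filterT.
by apply: le_ereal_inf_tmp => _ [t _ <-].
Qed.

Lemma limf_esup_einf_eq0 f : (forall t, 0 <= f t)%E ->
  limf_esup f 0^'+ = 0%E -> limf_einf f 0^'+ = 0%E.
Proof.
move=> f0 /(limf_esup_eq0P f0) h; apply/limf_einf_eq0P => // e s e0 s0.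
have [s' s'0 s'f] := h e e0.
have m0 : 0 < Num.min s s' by rewrite lt_min s0.
have h1 : Num.min s s' <= s by rewrite ge_min lexx.
have h2 : Num.min s s' <= s' by rewrite ge_min lexx orbT.
by exists (Num.min s s' / 2); [lra|apply: s'f; lra].
Qed.

Lemma limf_esup_le_eq0 f g (C : R) : 0 <= C ->
  (forall t, 0 <= f t)%E -> (forall t, 0 <= g t)%E ->
  (forall t, 0 < t -> (g t <= C%:E * f t)%E) ->
  limf_esup f 0^'+ = 0%E -> limf_esup g 0^'+ = 0%E.
Proof.
move=> C0 f0 g0 gf /(limf_esup_eq0P f0) h; apply/limf_esup_eq0P => // e e0.
have C1 : 0 < C + 1 by rewrite ltr_wpDl.
have [s s0 sf] := h (e / (C + 1)) (divr_gt0 e0 C1).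
exists s => // t /[dup] /andP[t0 _] /sf ft; apply: (le_trans (gf t t0)).
apply: (@le_trans _ _ (C%:E * (e / (C + 1))%:E)%E).
  by rewrite lee_wpmul2l ?lee_fin.
by rewrite -EFinM lee_fin mulrCA ger_pMr// ler_pdivrMr// mul1r lerDl.
Qed.

Lemma limf_einf_le_eq0 f g (C : R) : 0 <= C ->
  (forall t, 0 <= f t)%E -> (forall t, 0 <= g t)%E ->
  (forall t, 0 < t -> (g t <= C%:E * f t)%E) ->
  limf_einf f 0^'+ = 0%E -> limf_einf g 0^'+ = 0%E.
Proof.
move=> C0 f0 g0 gf /(limf_einf_eq0P f0) h; apply/limf_einf_eq0P => // e s e0 s0.
have C1 : 0 < C + 1 by rewrite ltr_wpDl.
have [t ts ft] := h (e / (C + 1)) s (divr_gt0 e0 C1) s0.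
exists t => //; have /andP[t0 _] := ts; apply: (le_trans (gf t t0)).
apply: (@le_trans _ _ (C%:E * (e / (C + 1))%:E)%E).
  by rewrite lee_wpmul2l ?lee_fin.
by rewrite -EFinM lee_fin mulrCA ger_pMr// ler_pdivrMr// mul1r lerDl.
Qed.

Lemma powR_small (a K e : R) : 0 < a -> 0 <= K -> 0 < e ->
  exists2 s : R, 0 < s & forall t, 0 < t < s -> K * t `^ a <= e.
Proof.
move=> a0 K0 e0; have K1 : 0 < K + 1 by rewrite ltr_wpDl.
have eK : 0 < e / (K + 1) by rewrite divr_gt0.
exists ((e / (K + 1)) `^ a^-1); first exact: powR_gt0.
move=> t /andP[t0 ts]; apply: (@le_trans _ _ (K * (e / (K + 1)))); last first.
  by rewrite mulrCA ger_pMr// ler_pdivrMr// mul1r lerDl.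
rewrite ler_wpM2l//.
have -> : e / (K + 1) = ((e / (K + 1)) `^ a^-1) `^ a.
  by rewrite -powRrM mulVf ?gt_eqF// powRr1// ltW.
by rewrite ge0_ler_powR// ?nnegrE ?powR_ge0// ltW.
Qed.

End limits_at_0.

(** * Growth of the parallel volume and nonvanishing of mu_0 *)

Lemma lebesgue_rV_ball (R : realType) (n : nat) (e : R) : 0 < e ->
  lebesgue_rV (ball (0 : 'rV[R]_n) e) = ((2 * e) ^+ n)%:E.
Proof.
move=> e0; elim: n => [|n IH] /=.
  by rewrite expr0 /dirac indicE mem_set//; exact: ballxx.
have [m [mE mfin]] := @lebesgue_rV_subproof R n.
move: IH; rewrite mE => IH; rewrite /pushforward rV_cons_ball//.
rewrite product_measure1E; [|exact: measurable_ball|exact: ball_rV_measurable].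
rewrite [X in (_ * X)%E]IH exprS EFinM; congr (_ * _)%E.
change (lebesgue_measure (ball (0 : R) e) = (2 * e)%:E).
by rewrite lebesgue_measure_ball ?ltW// mulr_natl.
Qed.

Section mu0.
Context (R : realType) (d : nat) (A : set 'rV[R]_d).
Context (d_gt0 : (0 < d)%N) (A_neq0 : A !=set0) (A_compact : compact A).
Context (mu : 'I_d -> signed_measure ('rV[R]_d * 'rV[R]_d)%type R).
Context (hmu : support_measures A mu).
Implicit Types (r s t q : R) (i : 'I_d).

Local Notation var i := (variation_measure (mu i)).

(** A_T contains the cube of half-side T/(2d) about 0: its points have Euclidean norm at most T/2,
    and [T0] makes |a| at most T/2 for a fixed a in A. *)
Lemma parallel_volume_ge : exists T0 : R, forall T, T0 <= T ->
  (((T / d%:R) ^+ d)%:E <= lebesgue_rV (parallel_set A T))%E.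
Proof.
have [a Aa] := A_neq0; exists (2 * enorm a + 1) => T hT.
have T0 : 0 < T by have := enorm_ge0 a; lra.
have d0 : 0 < d%:R :> R by rewrite ltr0n.
have e0 : 0 < T / (2 * d%:R) by rewrite divr_gt0// mulr_gt0.
have -> : (T / d%:R) = 2 * (T / (2 * d%:R)) by field; rewrite gt_eqF.
rewrite -lebesgue_rV_ball//; apply: le_measure; rewrite ?inE//.
- exact: ball_rV_measurable.
- exact: measurable_parallel_set.
move=> y; rewrite mx_norm_ball /ball_/= sub0r normrN => yT.
rewrite /parallel_set/=; apply: (le_trans (dist_le_enorm y Aa)).
apply: (le_trans (enormD _ _)); rewrite enormN.
have : enorm y <= d%:R * (T / (2 * d%:R)).
  by apply: (le_trans (enorm_le_norm _)); rewrite ler_pM2l// ltW.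
have -> : d%:R * (T / (2 * d%:R)) = T / 2 by field; rewrite gt_eqF.
lra.
Qed.

Lemma variation_eq0 i B : signed_measure_eq0 (mu i) -> measurable B ->
  var i B = 0%E.
Proof. by move=> h /h[p0 n0]; rewrite variationE p0 n0 adde0. Qed.

Lemma variation_reach_fin_num i t : 0 < t -> var i (reach_gt A t) \is a fin_num.
Proof.
by move=> t0; rewrite ge0_fin_numE ?measure_ge0//; exact: (variation_reach_lty A_neq0).
Qed.

(* Otherwise V(A_T) = O(T^(d-1)), whereas A_T contains a cube of side T/d.     *)
Lemma mu0_neq0 i : i = 0%N :> nat -> ~ signed_measure_eq0 (mu i).
Proof.
move=> i0 mu0; have [T0 hT0] := parallel_volume_ge.
have mP := measurable_parallel_set A_neq0.
pose b j := fine (var j (reach_gt A 1)).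
have bE j : var j (reach_gt A 1) = (b j)%:E.
  by rewrite fineK// variation_reach_fin_num.
have b0 j : 0 <= b j by rewrite fine_ge0// measure_ge0.
pose K := \sum_(j < d) `|omega R (d - j)| * b j.
have K0 : 0 <= K by apply: sumr_ge0 => j _; rewrite mulr_ge0.
have V1fin : lebesgue_rV (parallel_set A 1) \is a fin_num.
  rewrite ge0_fin_numE ?measure_ge0//.
  exact: (compact_lebesgue_lty (mP 1) (@compact_parallel_set _ _ _ A_neq0 A_compact 1)).
pose V1 := fine (lebesgue_rV (parallel_set A 1)).
have V10 : 0 <= V1 by rewrite fine_ge0// measure_ge0.
have main T : 1 <= T -> T0 <= T -> (T / d%:R) ^+ d <= (V1 + K) * T ^+ d.-1.
  move=> T1 TT0; rewrite -lee_fin; apply: (le_trans (hT0 T TT0)).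
  have T_gt0 : 0 < T by exact: lt_le_trans T1.
  have -> : parallel_set A T = parallel_set A 1 `|` (parallel_set A T `\` parallel_set A 1).
    rewrite setDUK// => y /=; rewrite /parallel_set/=; by move=> h; exact: le_trans T1.
  apply: (le_trans (measureU2 _ _ _)) => //; first exact: measurableD.
  apply: (@le_trans _ _ (V1%:E + (K * T ^+ d.-1)%:E)%E).
    apply: leeD; first by rewrite /V1 fineK.
    apply: (le_trans (shell_volume_le A_neq0 A_compact hmu ltr01 T1)).
    rewrite mulr_suml -sumEFin; apply: lee_sum => j _.
    (* Only the term of index 0 is of order T^d, and it vanishes; the others are O(T^(d-1)) as T >=
       1. *)
    rewrite bE -EFinM lee_fin mulrAC; have [ji|ji] := eqVneq j i.
      have -> : b j = 0 by rewrite /b ji variation_eq0//; exact: measurable_reach_gt.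
      by rewrite mulr0 !mul0r.
    rewrite ler_wpM2l ?mulr_ge0// ler_weXn2l//.
    have : (0 < j)%N by rewrite lt0n; apply: contra_neq ji => j0; apply/val_inj; rewrite /= j0 i0.
    by rewrite -subn1; exact: leq_sub2l.
  rewrite -EFinD lee_fin mulrDl lerD2r ler_peMr//.
  by rewrite exprn_ege1.
have d0 : 0 < d%:R :> R by rewrite ltr0n.
(* The inequality [main] would give T <= (V1 + K) d^d, against the last entry of the maximum. *)
pose T := Num.max (Num.max 1 T0) ((V1 + K) * d%:R ^+ d + 1).
have T1 : 1 <= T by rewrite /T !le_max lexx.
have TT0 : T0 <= T by rewrite /T !le_max lexx orbT.
have T2 : (V1 + K) * d%:R ^+ d + 1 <= T by rewrite /T le_max lexx orbT.
have T_gt0 : 0 < T by exact: lt_le_trans T1.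
have := main T T1 TT0; rewrite expr_div_n ler_pdivrMr ?exprn_gt0//.
rewrite -[in X in X <= _](prednK d_gt0) exprS mulrAC ler_pM2r ?exprn_gt0//.
by move: T2; lra.
Qed.

End mu0.

(** * Comparison of the basic exponents with the outer dimension *)

Section exponents.
Context (R : realType) (d : nat) (A : set 'rV[R]_d).
Context (A_neq0 : A !=set0) (A_compact : compact A).
Context (mu : 'I_d -> signed_measure ('rV[R]_d * 'rV[R]_d)%type R).
Context (hmu : support_measures A mu).
Implicit Types (r s t q : R) (i : 'I_d).

Local Notation var i := (variation_measure (mu i)).
Local Notation V t := (lebesgue_rV (parallel_set A t `\` A)).

Lemma scaled_beta_ge0 i q t :
  (0 <= (t `^ (q - i%:R))%:E * beta_var A (mu i) t)%E.
Proof.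
rewrite mule_ge0 ?lee_fin ?powR_ge0//; apply: integral_ge0 => p _.
by rewrite lee_fin.
Qed.

Lemma scaled_volume_ge0 q t : (0 <= (t `^ (q - d%:R))%:E * V t)%E.
Proof. by rewrite mule_ge0 ?lee_fin ?powR_ge0. Qed.

Lemma lower_le_upper_exponent i :
  (lower_exponent A i (mu i) <= upper_exponent A i (mu i))%E.
Proof.
apply: le_ereal_inf => _ [q hq <-]; exists q => //.
by apply: limf_esup_einf_eq0 hq => t; exact: scaled_beta_ge0.
Qed.

Lemma upper_exponent_eq0 i : signed_measure_eq0 (mu i) ->
  upper_exponent A i (mu i) = -oo%E.
Proof.
move=> mu0; have le_q q : (upper_exponent A i (mu i) <= q%:E)%E.
  apply: ereal_inf_lbound; exists q => //=.
  apply/limf_esup_eq0P => [t|e e0]; first exact: scaled_beta_ge0.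
  exists 1 => // t /andP[t0 _]; rewrite (beta_varE A_neq0) ?(ltW t0)//.
  by rewrite variation_eq0 ?mule0 ?lee_fin ?ltW//; exact: measurable_reach_gt.
case: (upper_exponent _ _ _) le_q => [r /(_ (r - 1))|/(_ 0)|//].
  by rewrite lee_fin => ?; exfalso; lra.
by rewrite leye_eq.
Qed.

(** N(A) is the union of the N_(1/(k+1)), so a nonzero mu_i has mass b > 0 on some N_t. For q < i
    and s < min(t, 1) one has s^(q-i) >= 1 and |mu_i|(N_s) >= b, which keeps the liminf away from
    0. *)
Lemma lower_exponent_ge i : ~ signed_measure_eq0 (mu i) ->
  (i%:R%:E <= lower_exponent A i (mu i))%E.
Proof.
move=> mu_neq0.
have [t t0 bt] : exists2 t, 0 < t & (0 < var i (reach_gt A t))%E.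
  apply: contrapT => nt; apply: mu_neq0 => B mB.
  have r0 t : 0 < t -> var i (reach_gt A t) = 0%E.
    move=> t0; apply/eqP; rewrite eq_le measure_ge0 andbT leNgt; apply/negP => h.
    by apply: nt; exists t.
  have [hN _ _] := hmu.
  have mN := measurable_normal_bundle A_neq0 A_compact.
  have NE : normal_bundle A = \bigcup_k reach_gt A k.+1%:R^-1.
    rewrite normal_bundle_reach//; apply/seteqP; split => [p [Ap p1 [x x0 dx]]|p [k _]].
      exists (Num.truncn (ratr x : R)^-1) => //; split => //; exists x => //.
      by rewrite invf_plt ?posrE// real_truncnS_gt// num_real.
    by apply: reach_gt_sub; rewrite invr_ge0.
  have N0 : var i (normal_bundle A) = 0%E.
    apply/eqP; rewrite eq_le measure_ge0 andbT NE.
    apply: (le_trans (measure_sigma_subadditive _ _ _ (@subset_refl _ _))).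
    - by move=> k; exact: measurable_reach_gt.
    - by apply: bigcup_measurable => k _; exact: measurable_reach_gt.
    by rewrite eseries0// => k _ _; rewrite r0.
  have B0 : var i B = 0%E.
    have nC : var i (~` normal_bundle A) = 0%E.
      by apply: measure_negligible (hN i); exact: measurableC.
    apply/eqP; rewrite eq_le measure_ge0 andbT.
    have mC : measurable (~` normal_bundle A) by exact: measurableC.
    apply: (@le_trans _ _ (var i (normal_bundle A `|` ~` normal_bundle A))).
      by apply: le_measure; rewrite ?inE//; [exact: measurableU|rewrite setUv].
    apply: (le_trans (measureU2 _ _ _)) => //.
    by rewrite [X in (X + _)%E](N0) [X in (_ + X)%E](nC) adde0.
  have [p0 n0] := parts_le_variation mu i B.
  by split; apply/eqP; rewrite eq_le measure_ge0 andbT -B0.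
apply: le_ereal_inf_tmp => _ [q hq <-]; rewrite lee_fin leNgt; apply/negP => qi.
have /limf_einf_eq0P := hq => /(_ (scaled_beta_ge0 i q)) h.
have bfin := variation_reach_fin_num A_neq0 A_compact hmu i t0.
pose b := fine (var i (reach_gt A t)).
have bE : var i (reach_gt A t) = b%:E by rewrite fineK.
have b0 : 0 < b by rewrite -lte_fin -bE.
have [] := h (b / 2) (Num.min t 1); first by rewrite divr_gt0.
  by rewrite lt_min t0 ltr01.
move=> s /andP[s0]; rewrite lt_min => /andP[st s1].
rewrite (beta_varE A_neq0)//; last exact: ltW.
apply/negP; rewrite -ltNge.
apply: (@lt_le_trans _ _ b%:E); first by rewrite lte_fin; lra.
apply: (@le_trans _ _ (var i (reach_gt A s))).
  rewrite -bE; apply: le_measure; rewrite ?inE.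
  - exact: measurable_reach_gt.
  - exact: measurable_reach_gt.
  - by apply: reach_gt_sub; exact: ltW.
rewrite -[X in (X <= _)%E]mul1e; apply: lee_pmul => //.
rewrite lee_fin -[X in X <= _](powRr0 s) ger_powR ?s0 ?(ltW s1)//.
by rewrite subr_le0 ltW.
Qed.

Lemma scaled_beta_le_volume : exists2 C : 'I_d -> R, (forall i, 0 <= C i) &
  forall i q t, 0 < t -> ((t `^ (q - i%:R))%:E * beta_var A (mu i) t <=
    (C i)%:E * ((t `^ (q - d%:R))%:E * V t))%E.
Proof.
have [C C0 hC] := variation_le_volume A_neq0 A_compact hmu.
exists C => // i q t t0; rewrite (beta_varE A_neq0) ?(ltW t0)//.
apply: (le_trans (lee_wpmul2l _ (hC i t t0))); first by rewrite lee_fin powR_ge0.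
rewrite !muleA -!EFinM lee_wpmul2r ?measure_ge0// lee_fin.
rewrite mulrCA -[t ^+ _]powR_mulrn ?(ltW t0)// -powRN -powRD; last first.
  by apply/implyP => _; rewrite gt_eqF.
suff -> : q - i%:R - (d - i)%:R = q - d%:R by [].
by rewrite natrB ?(ltnW (ltn_ord i))//; ring.
Qed.

Lemma upper_exponent_le_dim i : (upper_exponent A i (mu i) <= upper_dim_out A)%E.
Proof.
have [C C0 hC] := scaled_beta_le_volume.
apply: le_ereal_inf => _ [q [_ hq] <-]; exists q => //.
apply: limf_esup_le_eq0 (C0 i) _ _ (hC i q) hq => t.
  exact: scaled_volume_ge0.
exact: scaled_beta_ge0.
Qed.

Lemma lower_exponent_le_dim i : (lower_exponent A i (mu i) <= lower_dim_out A)%E.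
Proof.
have [C C0 hC] := scaled_beta_le_volume.
apply: le_ereal_inf => _ [q [_ hq] <-]; exists q => //.
apply: limf_einf_le_eq0 (C0 i) _ _ (hC i q) hq => t.
  exact: scaled_volume_ge0.
exact: scaled_beta_ge0.
Qed.

(** Continuity from above: the sets A_t \ A have finite volume and decrease to the empty set, A
    being closed. *)
Lemma outer_volume_cvg0 e : 0 < e ->
  exists2 s, 0 < s & forall t, 0 < t < s -> (V t <= e%:E)%E.
Proof.
move=> e0; have mA := measurable_compact A_neq0 A_compact.
have mV t : measurable (parallel_set A t `\` A).
  by apply: measurableD => //; exact: measurable_parallel_set.
pose F k := parallel_set A k.+1%:R^-1 `\` A.
have capF : \bigcap_k F k = set0.
  apply/seteqP; split => // y yF; have [_ nA] := yF 0%N I.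
  have y0 : 0 < dist A y by apply/dist_gt0.
  have := (yF (Num.truncn (dist A y)^-1) I).1; rewrite /parallel_set/=.
  apply/negP; rewrite -ltNge invf_plt ?posrE//.
  by rewrite real_truncnS_gt// num_real.
have Fcvg : (@lebesgue_rV R d \o F) @ \oo --> lebesgue_rV (\bigcap_k F k).
  apply: nonincreasing_cvg_mu.
  - exact: parallel_volume_lty.
  - by move=> k; exact: mV.
  - by rewrite capF.
  - apply/nonincreasing_seqP => k; apply/subsetPset => y [yk nA]; split => //.
    by apply: le_trans yk _; rewrite lef_pV2 ?posrE// ler_nat.
have : nbhs (lebesgue_rV (\bigcap_k F k)) [set x | (x < e%:E)%E].
  apply: open_nbhs_nbhs; split; first exact: open_ereal_lt_ereal.
  by rewrite capF /= measure0 lte_fin.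
move=> /Fcvg[k _ hk]; exists k.+1%:R^-1 => // t /andP[t0 tk].
apply: le_trans (ltW (hk k (leqnn k))); apply: le_measure; rewrite ?inE; [exact: mV|exact: mV|].
by move=> y [yt nA]; split => //; apply: le_trans yt (ltW tk).
Qed.

Lemma upper_dim_out_le : (upper_dim_out A <= d%:R%:E)%E.
Proof.
apply: ereal_inf_lbound; exists d%:R => //; split => //.
apply/limf_esup_eq0P => [t|e e0]; first exact: scaled_volume_ge0.
have [s s0 hs] := outer_volume_cvg0 e0; exists s => // t ts.
by rewrite subrr powRr0 mul1e hs.
Qed.

(* Sum the shells A_(t/2^k) \ A_(t/2^(k+1)): their volumes decay geometrically *)
(* as q < d.                                                                   *)
Lemma volume_le_powR q s : q < d%:R -> 0 < s ->
  (forall i t, 0 < t < s -> ((t `^ (q - i%:R))%:E * beta_var A (mu i) t <= 1)%E) ->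
  exists2 K, 0 <= K & forall t, 0 < t < s -> (V t <= (K * t `^ (d%:R - q))%:E)%E.
Proof.
move=> qd s0 hb.
have mA := measurable_compact A_neq0 A_compact.
have mP t := measurable_parallel_set A_neq0 t.
have Vfin t : V t \is a fin_num.
  by rewrite ge0_fin_numE ?measure_ge0//; exact: parallel_volume_lty.
pose v t := fine (V t).
have vE t : V t = (v t)%:E by rewrite fineK.
(* The hypothesis at t/2 reads |mu_i|(N_(t/2)) <= (t/2)^(i-q); times the shell factor t^(d-i) this
   is 2^(q-i) t^(d-q). *)
pose K1 := \sum_(i < d) `|omega R (d - i)| * 2 `^ (q - i%:R).
have K10 : 0 <= K1 by apply: sumr_ge0 => i _; rewrite mulr_ge0 ?powR_ge0.
pose a := d%:R - q; have a0 : 0 < a by rewrite subr_gt0.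
pose l := 2^-1 `^ a.
have l1 : l < 1.
  suff : l < 1 `^ a by rewrite powR1.
  apply: gt0_ltr_powR; rewrite ?nnegrE//.
  by rewrite invf_lt1// ltr1n.
have step t : 0 < t < s -> v t <= v (t / 2) + K1 * t `^ a.
  move=> /andP[t0 ts]; have t2 : 0 < t / 2 by rewrite divr_gt0.
  have t2t : t / 2 <= t by lra.
  rewrite -lee_fin -vE.
  have -> : parallel_set A t `\` A = (parallel_set A (t / 2) `\` A) `|`
      (parallel_set A t `\` parallel_set A (t / 2)).
    apply/seteqP; split => y; rewrite /parallel_set/=.
      move=> [yt nA]; have [h|h] := leP (dist A y) (t / 2); [left|right] => //.
    move=> [[h nA]|[yt h]]; split => //; first exact: le_trans t2t.
    by move=> Ay; apply: h; rewrite dist_mem// ltW.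
  apply: (le_trans (measureU2 _ _ _)); [exact: measurableD|exact: measurableD|].
  rewrite EFinD; apply: leeD; first by rewrite /v fineK.
  apply: (le_trans (shell_volume_le A_neq0 A_compact hmu t2 t2t)).
  rewrite mulr_suml -sumEFin; apply: lee_sum => i _.
  have bfin := variation_reach_fin_num A_neq0 A_compact hmu i t2.
  have := hb i (t / 2); rewrite t2 (le_lt_trans t2t ts) => /(_ isT).
  rewrite (beta_varE A_neq0) ?(ltW t2)// -(fineK bfin) -!EFinM !lee_fin => hbi.
  rewrite -!mulrA ler_wpM2l//.
  have -> : 2 `^ (q - i%:R) * t `^ a = t ^+ (d - i) * (t / 2) `^ (i%:R - q).
    rewrite powRM ?(ltW t0)// -[2^-1]powR_inv1// -powRrM mulN1r opprB.
    rewrite mulrA [RHS]mulrC; congr (_ * _); rewrite -powR_mulrn ?(ltW t0)// -powRD.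
      by congr (_ `^ _); rewrite natrB ?(ltnW (ltn_ord i))// /a; ring.
    by apply/implyP => _; rewrite gt_eqF.
  rewrite ler_wpM2l ?exprn_ge0 ?(ltW t0)//.
  rewrite -[i%:R - q]opprB powRN -[X in _ <= X]mul1r ler_pdivlMr ?powR_gt0//.
  by rewrite mulrC.
have l0 : 0 < 1 - l by rewrite subr_gt0.
(* The sum of the geometric series of ratio l = 2^(q-d), that is, the solution of K = K1 + l K used
   in the induction [iter]. *)
exists (K1 / (1 - l)) => [|t ts]; first by rewrite divr_ge0// ltW.
set K := K1 / (1 - l).
have iter n u : 0 < u < s -> v u <= v (u / 2 ^+ n) + K * u `^ a.
  elim: n u => [u us|n IH u /[dup] us /andP[u0 us']].
    by rewrite expr0 divr1 lerDl mulr_ge0 ?powR_ge0// divr_ge0// ltW.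
  have u2 : 0 < u / 2 < s by apply/andP; split; lra.
  apply: (le_trans (step u us)); have := IH _ u2.
  have -> : u / 2 / 2 ^+ n = u / 2 ^+ n.+1.
    by rewrite exprS invfM mulrA.
  have -> : (u / 2) `^ a = l * u `^ a by rewrite powRM ?(ltW u0)// mulrC.
  have -> : K1 = K * (1 - l) by rewrite /K divfK// gt_eqF.
  lra.
(* The remainder v(t / 2^n) of the iteration drops below any e > 0. *)
have /andP[t0 _] := ts; rewrite vE lee_fin; apply/ler_addgt0Pl => e e0.
have [r r0 hr] := outer_volume_cvg0 e0.
have [n hn] : exists n, t / 2 ^+ n < r.
  exists (Num.truncn (t / r)); rewrite ltr_pdivrMr ?exprn_gt0// mulrC -ltr_pdivrMr//.
  apply: (lt_le_trans (real_truncnS_gt (num_real _))).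
  by rewrite -natrX ler_nat ltn_expl.
apply: (le_trans (iter n t ts)); rewrite lerD2r -lee_fin -vE; apply: hr.
by rewrite hn divr_gt0// exprn_gt0.
Qed.

Lemma upper_dim_out_le_max (m : R) :
  (forall i, (upper_exponent A i (mu i) <= m%:E)%E) -> 0 <= m ->
  (upper_dim_out A <= m%:E)%E.
Proof.
move=> hm m0; have [dm|md] := leP d%:R m.
  by apply: (le_trans upper_dim_out_le); rewrite lee_fin.
apply/lee_addgt0Pr => e e0; rewrite -EFinD.
(* The cap at d and the midpoint q' < q give d - q' > 0, as the geometric summation requires. The
   gap q - q' then makes t^(q-d) v(t) = O(t^(q-q')) tend to 0. *)
pose q := Num.min (m + e) d%:R.
have mq : m < q by rewrite /q lt_min md ltrDl e0.
have qe : q <= m + e by rewrite /q ge_min lexx.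
have qd : q <= d%:R by rewrite /q ge_min lexx orbT.
apply: (@le_trans _ _ q%:E); last by rewrite lee_fin.
pose q' := (m + q) / 2; have q'q : q' < q by rewrite /q'; lra.
have mq' : m < q' by rewrite /q'; lra.
have [s s0 hs] : exists2 s, 0 < s & forall t, 0 < t < s -> forall i,
    ((t `^ (q' - i%:R))%:E * beta_var A (mu i) t <= 1)%E.
  (* One radius s serves all of the finitely many indices. *)
  apply/at_right0P; apply: (@filter_forall R 'I_d (fun i t =>
    ((t `^ (q' - i%:R))%:E * beta_var A (mu i) t <= 1)%E) 0^'+ _) => i.
  apply/at_right0P.
  have : (upper_exponent A i (mu i) < q'%:E)%E.
    by apply: (le_lt_trans (hm i)); rewrite lte_fin.
  move=> /ereal_inf_lt[_ [p hp <-]]; rewrite lte_fin => pq'.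
  have [s s0 hs] := (limf_esup_eq0P (scaled_beta_ge0 i p)).1 hp 1 ltr01.
  exists (Num.min s 1) => [|t /andP[t0]]; first by rewrite lt_min s0 ltr01.
  rewrite lt_min => /andP[ts t1].
  apply: le_trans (hs t _); last by rewrite t0.
  apply: lee_wpmul2r; first by apply: integral_ge0 => x _; rewrite lee_fin.
  by rewrite lee_fin ger_powR ?t0 ?(ltW t1)// lerD2r ltW.
have [K K0 hK] := volume_le_powR (lt_le_trans q'q qd) s0 (fun i t ts => hs t ts i).
apply: ereal_inf_lbound; exists q => //; split; first exact: le_trans m0 (ltW mq).
apply/limf_esup_eq0P => [t|eps eps0]; first exact: scaled_volume_ge0.
have qq'0 : 0 < q - q' by rewrite subr_gt0.
have [s' s'0 hs'] := powR_small qq'0 K0 eps0.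
exists (Num.min s s') => [|t /andP[t0]]; first by rewrite lt_min s0.
rewrite lt_min => /andP[ts ts'].
apply: (@le_trans _ _ ((t `^ (q - d%:R))%:E * (K * t `^ (d%:R - q'))%:E)%E).
  by rewrite lee_wpmul2l ?lee_fin ?powR_ge0// hK// t0.
rewrite -EFinM lee_fin mulrCA -powRD; last by apply/implyP => _; rewrite gt_eqF.
have -> : q - d%:R + (d%:R - q') = q - q' by ring.
by apply: hs'; rewrite t0.
Qed.

End exponents.

Theorem theorem3p8 (R : realType) (d : nat) (hd : (2 <= d)%N)
    (A : set 'rV[R]_d) (A_neq0 : A !=set0) (A_compact : compact A)
    (mu : 'I_d -> signed_measure ('rV[R]_d * 'rV[R]_d)%type R)
    (hmu : support_measures A mu) :
  [/\ forall i : 'I_d,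
        [/\ signed_measure_eq0 (mu i),
            lower_exponent A i (mu i) = -oo%E &
            upper_exponent A i (mu i) = -oo%E] \/
        ((i%:R)%:E <= lower_exponent A i (mu i) /\
         lower_exponent A i (mu i) <= upper_exponent A i (mu i))%E,
      forall i : 'I_d, i = 0%N :> nat -> ~ signed_measure_eq0 (mu i),
      \big[maxe/-oo%E]_(i < d) upper_exponent A i (mu i) = upper_dim_out A
    & (\big[maxe/-oo%E]_(i < d) lower_exponent A i (mu i) <= lower_dim_out A)%E].
Proof.
have d0 : (0 < d)%N by exact: leq_trans hd.
split=> [i|i i0||].
- have [mu0|mu_neq0] := pselect (signed_measure_eq0 (mu i)).
    left; have u0 := upper_exponent_eq0 A_neq0 A_compact mu0.
    split => //; apply/eqP; rewrite -leeNy_eq -u0.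
    exact: lower_le_upper_exponent.
  right; split; last exact: lower_le_upper_exponent.
  exact: lower_exponent_ge.
- exact: (mu0_neq0 d0 A_neq0 A_compact hmu).
- apply/eqP; rewrite eq_le; apply/andP; split.
    by apply: bigmax_le => [|i _]; [rewrite leNye|exact: upper_exponent_le_dim].
  have le_max (i : 'I_d) : (upper_exponent A i (mu i) <=
      \big[maxe/-oo]_(i < d) upper_exponent A i (mu i))%E by exact: le_bigmax.
  have max0 : (0 <= \big[maxe/-oo]_(i < d) upper_exponent A i (mu i))%E.
    apply: le_trans (le_max (Ordinal d0)).
    apply: le_trans (lower_le_upper_exponent _ _ _).
    have := lower_exponent_ge A_neq0 A_compact hmu
      (mu0_neq0 d0 A_neq0 A_compact hmu (erefl : Ordinal d0 = 0%N :> nat)).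
    exact.
  (* Nonnegativity excludes the value -oo and supplies the hypothesis 0 <= m; at +oo there is
     nothing to show. *)
  move: max0 le_max; case: (\big[_/_]_(i < d) _) => [m|_ _|//].
    rewrite lee_fin => m0 le_max.
    exact: (upper_dim_out_le_max A_neq0 A_compact hmu).
  by rewrite leey.
- by apply: bigmax_le => [|i _]; [rewrite leNye|exact: lower_exponent_le_dim].
Qed.
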